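(* Assume the standing assumptions (S) and let $$M^{(N)}:=\frac{1}{\sqrt N}\Big(\alpha\big(\tfrac{|i-j|}{N}\big)X^{(N)}_{ij}\Big)_{1\le i,j\le N}.$$ Then for every $k\in\mathbb N$ the limit $\mu_k:=\lim_{N\to\infty}\frac1N\,\mathbb E\big(\operatorname{tr}(M^{(N)})^k\big)$ exists and $$\mu_k=\begin{cases}\sum_{\pi\in\mathcal B_{k/2}}J_\alpha(\pi)&k\text{ even},\\ 0&k\text{ odd.}\end{cases}$$
   Context: Standing assumptions (S): $\alpha:[0,1]\to\mathbb R$ is bounded and Riemann-integrable. For each $N\in\mathbb N$, $(X^{(N)}_{ij})_{1\le i,j\le N}$ are real random variables on a common probability space with $X^{(N)}_{ij}=X^{(N)}_{ji}$, $\mathbb E X^{(N)}_{ij}=0$, $\mathbb E (X^{(N)}_{ij})^2=1$, and $\sup_N\max_{i,j}\mathbb E|X^{(N)}_{ij}|^k\le R_k<\infty$ for every $k\ge 1$. For each $N$, $\sim$ is an equivalence relation on $\{1,\dots,N\}^2$ with $(p,q)\sim(q,p)$ for all $p,q$, satisfying, as $N\to\infty$: (C1) $\max_p\#\{(q,r,s)\in\{1,\dots,N\}^3:(p,q)\sim(r,s)\}=o(N^2)$; (C2) $\max_{p,q,r}\#\{s\in\{1,\dots,N\}:(p,q)\sim(r,s)\}\le B<\infty$ with $B$ independent of $N$; (C3) $\#\{(p,q,r)\in\{1,\dots,N\}^3:(p,q)\sim(q,r),\ r\neq p\}=o(N^2)$. Entries indexed by non-equivalent pairs are independent: for each $N$,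 the families $\{X^{(N)}_{pq}:(p,q)\in C\}$, $C$ ranging over the distinct $\sim$-equivalence classes, are mutually independent. $\mathcal B_{k/2}$ ($k$ even) is the set of non-crossing pair-partitions of $\{1,\dots,k\}$ (partitions into 2-element blocks with no $1\le a<b<c<d\le k$ such that $\{a,c\},\{b,d\}$ are both blocks). The integral $J_\alpha$: for $\pi\in\mathcal B_{k/2}$, let $G(\pi)=(G_1,\dots,G_k)$ be a $\pi$-adopted sequence in a countably infinite set $\mathcal G$ (it exists, is unique up to a bijection of $\mathcal G$, and has exactly $k/2+1$ distinct entries); let $V_\pi=\{G_1,\dots,G_k\}$ and $\mathcal K_\pi=\{\{G_j,G_{j+1}\}:1\le j\le k\}$ with $G_{k+1}:=G_1$ (a set of $2$-element subsets of $V_\pi$). Then $$J_\alpha(\pi):=\int_{[0,1]^{V_\pi}}\prod_{\{u,v\}\in\mathcal K_\pi}\alpha^2(|x_u-x_v|)\,dx .$$ Here $\pi$-adopted is defined recursively in $k$: for $k=2$, $(g_1,g_2)$ is $\{\{1,2\}\}$-adopted iff $g_1\ne g_2$; for $k\ge4$, $g$ is $\pi$-adopted iff for every block $\{m,m+1\}\in\pi$ with $1\le m\le k-2$: $g_m=g_{m+2}$, $g_{m+1}\neq g_s$ for all $s\neq m+1$, and $(g_1,\dots,g_m,g_{m+3},\dots,g_k)$ is adopted for the partition of $\{1,\dots,k-2\}$ obtained from $\pi$ by deleting $\{m,m+1\}$ and relabelling each remaining $a>m$ as $a-2$. *)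

(* Defs.v *)
From HB Require Import structures.
From mathcomp Require Import all_boot all_order all_algebra.
From mathcomp Require Import all_classical all_reals all_analysis.
From Stdlib Require Import ClassicalEpsilon.
Set Implicit Arguments. Unset Strict Implicit. Unset Printing Implicit Defensive.
Import Order.TTheory GRing.Theory Num.Theory.
Import numFieldNormedType.Exports.
Local Open Scope classical_set_scope.
Local Open Scope ring_scope.

Section Defs.
Variable R : realType.

Definition riemann_integrable01 (f : R -> R) : Prop :=
  exists I : R, forall eps : R, 0 < eps -> exists2 delta : R, 0 < delta &
    forall (n : nat) (t xi : nat -> R),
      t 0%N = 0 -> t n = 1 ->
      (forall i, (i < n)%N ->
         [/\ t i <= t i.+1, t i.+1 - t i < delta & t i <= xi i <= t i.+1]) ->
      `| \sum_(i < n) f (xi i) * (t i.+1 - t i) - I | < eps.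

Fixpoint cube_int (n : nat) (f : seq R -> \bar R) : \bar R :=
  match n with
  | 0%N => f [::]
  | n'.+1 => (\int[@lebesgue_measure R]_(t in `[0%R, 1%R]%classic)
                cube_int n' (fun xs => f (t :: xs)))%E
  end.
End Defs.

(* Pair partitions of {0,..,k-1} encoded by the partner map p. *)
Definition is_ncpp (k : nat) (p : {ffun 'I_k -> 'I_k}) : bool :=
  [forall i, (p i != i) && (p (p i) == i)] &&
  ~~ [exists a : 'I_k, exists b : 'I_k, (a < b)%N && (b < p a)%N && (p a < p b)%N].

Definition ppseq (k : nat) (p : {ffun 'I_k -> 'I_k}) : seq nat :=
  [seq nat_of_ord (p i) | i <- enum 'I_k].

Definition del_block (m : nat) (s : seq nat) : seq nat :=
  [seq (if (m.+1 < a)%N then a - 2 else a)%N | a <- take m s ++ drop m.+2 s].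

Fixpoint adoptedF (fuel : nat) (s g : seq nat) : Prop :=
  match fuel with
  | 0%N => False
  | fuel'.+1 =>
    if size s == 2%N then nth 0%N g 0 <> nth 0%N g 1
    else forall m, (m.+2 < size s)%N -> nth 0%N s m = m.+1 ->
      [/\ nth 0%N g m = nth 0%N g m.+2,
          (forall t, (t < size s)%N -> t <> m.+1 -> nth 0%N g m.+1 <> nth 0%N g t)
        & adoptedF fuel' (del_block m s) (take m.+1 g ++ drop m.+3 g)]
  end.

Definition adopted (s g : seq nat) : Prop :=
  size g = size s /\ adoptedF (size s) s g.

Definition Gseq (s : seq nat) : seq nat :=
  epsilon (inhabits [::]) (fun g => adopted s g).

(* edge set K_pi as unordered pairs (min, max), cyclic *)
Definition edges (g : seq nat) : seq (nat * nat) :=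
  undup [seq (minn (nth 0%N g j) (nth 0%N g (j.+1 %% size g)),
              maxn (nth 0%N g j) (nth 0%N g (j.+1 %% size g))) | j <- iota 0 (size g)].

Definition Jalpha (R : realType) (alpha : R -> R) (s : seq nat) : R :=
  let g := Gseq s in
  let V := undup g in
  let coord (x : seq R) (u : nat) := nth 0 x (index u V) in
  fine (cube_int (size V) (fun x =>
    (\prod_(e <- edges g) (alpha `|coord x e.1 - coord x e.2|) ^+ 2)%:E)).

Section RM.
Context (R : realType) (d : measure_display) (T : measurableType d)
        (P : probability T R).

Definition Mmat (alpha : R -> R) (N : nat) (X : 'I_N -> 'I_N -> {RV P >-> R})
  (w : T) : 'M[R]_N :=
  \matrix_(i, j) ((Num.sqrt (N%:R))^-1 * alpha (`|(i%:R : R) - j%:R| / N%:R)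
                   * X i j w).

Definition moment (alpha : R -> R) (X : forall N : nat, 'I_N -> 'I_N -> {RV P >-> R})
  (k N : nat) : R :=
  (N%:R)^-1 * fine ('E_P[fun w => \tr (Mmat alpha (X N) w ^+ k)])%E.

(* the families indexed by distinct equivalence classes are mutually
   independent (product rule on the generating cylinder events) *)
Definition indep_classes (N : nat) (X : 'I_N -> 'I_N -> {RV P >-> R})
  (eqv : rel ('I_N * 'I_N)) : Prop :=
  forall B : 'I_N * 'I_N -> set R, (forall p, measurable (B p)) ->
    P (\bigcap_(p in [set: 'I_N * 'I_N]) (X p.1 p.2 @^-1` B p)) =
    (\prod_(C in [set [set q | eqv p q] | p : 'I_N * 'I_N]%SET)
       P (\bigcap_(p in [set p | p \in C]) (X p.1 p.2 @^-1` B p)))%E.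
End RM.

(* Main.v *)
Require Import Defs.
From HB Require Import structures.
From mathcomp Require Import all_boot all_order all_algebra.
From mathcomp Require Import all_classical all_reals all_analysis.
From mathcomp Require Import measurable_realfun zify ring lra.
Set Implicit Arguments. Unset Strict Implicit. Unset Printing Implicit Defensive.
Import Order.TTheory GRing.Theory Num.Theory.
Import numFieldNormedType.Exports.

(** Expand the trace over closed walks [i_1, ..., i_k] in [{1..N}] with edges
    [e_j = (i_j, i_(j+1))]. By independence a walk contributes only if every edge is
    equivalent to another one, and walking along the tuple, (C2) leaves a bounded choice
    whenever an edge is equivalent to an earlier one; so tuples with fewer than [k/2] classes
    are negligible and the edge classes may be assumed to form a pairing. If the pairing has
    two adjacent partners, then either [i_m <> i_(m+2)], which is rare by (C3), or the two
    edges can be deleted; if it has none, a block of minimal length is rare by (C1). Deletion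
    thus shows that, up to [o(N^(k/2+1))] tuples, the pairing is noncrossing and the walk
    folds onto a tree with [k/2] edges, each traversed once in either direction. These walks
    have expectation one, and their weights form a Riemann sum for [J_alpha]. The iterated
    integral is sandwiched between the lower and upper sums on the same grid [1/N], so no
    measurability of [alpha] is needed. *)

(** * Noncrossing pairings and folded walks *)

Definition fixfree_involution k (f : nat -> nat) : Prop :=
  forall j, j < k -> [/\ f j < k, f j != j & f (f j) = j].

Lemma count_lt_involution k (f : nat -> nat) : fixfree_involution k f ->
  (count (fun j => j < f j) (iota 0 k)).*2 = k.
Proof.
move=> fP.
have f_perm : perm_eq (map f (iota 0 k)) (iota 0 k).
  have f_sub : {subset map f (iota 0 k) <= iota 0 k}.
    by move=> _ /mapP[j + ->]; rewrite !mem_iota => /fP[].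
  have f_uniq : uniq (map f (iota 0 k)).
    rewrite map_inj_in_uniq ?iota_uniq // => i j.
    by rewrite !mem_iota => /fP[_ _ fi] /fP[_ _ fj] ij; rewrite -fi ij fj.
  apply: uniq_perm; rewrite ?iota_uniq //.
  by have [|//] := uniq_min_size f_uniq f_sub; rewrite size_map.
have count_gt : count (fun j => j < f j) (iota 0 k) = count (fun j => f j < j) (iota 0 k).
  rewrite -(permP f_perm) count_map; apply: eq_in_count => j.
  by rewrite mem_iota => /fP[_ _ /= ->].
rewrite -addnn {2}count_gt -[RHS](size_iota 0) -(count_predC (fun j => j < f j)).
by congr addn; apply: eq_in_count => j; rewrite mem_iota => /fP[_ /= + _]; lia.
Qed.

Definition pairing (s : seq nat) : Prop := fixfree_involution (size s) (nth 0 s).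

Definition noncrossing (s : seq nat) : Prop := forall a b,
  a < size s -> b < size s -> a < b -> b < nth 0 s a -> nth 0 s a < nth 0 s b -> False.

Lemma pairing_even s : pairing s -> ~~ odd (size s).
Proof. by move=> /count_lt_involution <-; rewrite odd_double. Qed.

Lemma pairing2 s : pairing s -> size s = 2 -> s = [:: 1; 0].
Proof.
case: s => [//|a [//|b [|//]]] sP _.
have [/= a_lt a_neq _] := sP 0 isT; have [/= b_lt b_neq _] := sP 1 isT.
by congr [:: _; _]; lia.
Qed.

(* [skip m] enumerates the positions other than [m] and [m.+1]; [unskip m] is its inverse. *)
Definition skip m j := if j < m then j else j.+2.
Definition unskip m a := if m.+1 < a then a - 2 else a.

Lemma skipK m : cancel (skip m) (unskip m).
Proof. by move=> j; rewrite /skip /unskip; case: (ltnP j m) => ?; case: ifP; lia. Qed.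

Lemma unskipK m a : a != m -> a != m.+1 -> skip m (unskip m a) = a.
Proof. by rewrite /skip /unskip; case: (ltnP m.+1 a) => ?; case: ifP; lia. Qed.

Lemma skip_neq m j : skip m j != m /\ skip m j != m.+1.
Proof. by rewrite /skip; case: ifP; lia. Qed.

Lemma skip_mono m : {mono skip m : a b / a < b}.
Proof. by move=> a b; rewrite /skip; case: ifP; case: ifP; lia. Qed.

Lemma skip_lt m n j : m.+1 < n -> j < n - 2 -> skip m j < n.
Proof. by rewrite /skip; case: ifP; lia. Qed.

Lemma unskip_lt m n a : m.+1 < n -> a < n -> a != m -> a != m.+1 -> unskip m a < n - 2.
Proof. by rewrite /unskip; case: ifP; lia. Qed.

Section DeleteBlock.
Variables (m : nat) (s : seq nat).
Hypothesis ms : m.+1 < size s.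

Lemma size_del_block : size (del_block m s) = size s - 2.
Proof. by rewrite size_map size_cat size_drop size_takel; lia. Qed.

Lemma nth_del_block j : j < size s - 2 ->
  nth 0 (del_block m s) j = unskip m (nth 0 s (skip m j)).
Proof.
move=> js; rewrite (nth_map 0); last by rewrite size_cat size_drop size_takel; lia.
rewrite nth_cat size_takel; last lia.
rewrite /skip; case: (ltnP j m) => jm; first by rewrite nth_take.
by rewrite nth_drop (_ : m.+2 + (j - m) = j.+2) //; lia.
Qed.

Hypotheses (sP : pairing s) (sm : nth 0 s m = m.+1).

Lemma partner_adj : nth 0 s m.+1 = m.
Proof. by have [_ _] := sP (ltnW ms); rewrite sm. Qed.

Lemma partner_neq_adj a : a < size s -> a != m -> a != m.+1 ->
  nth 0 s a != m /\ nth 0 s a != m.+1.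
Proof.
move=> a_lt; have [_ _ aK] := sP a_lt.
by split; apply/eqP => e; move: aK; rewrite e ?sm ?partner_adj; lia.
Qed.

Lemma skip_del_block j : j < size s - 2 ->
  skip m (nth 0 (del_block m s) j) = nth 0 s (skip m j).
Proof.
move=> js; have [neq_m neq_m1] := skip_neq m j.
have [pneq_m pneq_m1] := partner_neq_adj (skip_lt ms js) neq_m neq_m1.
by rewrite nth_del_block // unskipK.
Qed.

Lemma pairing_del : pairing (del_block m s).
Proof.
move=> j; rewrite size_del_block => js.
have [p_lt p_neq pK] := sP (skip_lt ms js).
have del_lt : nth 0 (del_block m s) j < size s - 2.
  have [neq_m neq_m1] := skip_neq m j.
  have [pneq_m pneq_m1] := partner_neq_adj (skip_lt ms js) neq_m neq_m1.
  by rewrite nth_del_block // unskip_lt.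
split=> //.
- by apply: contra_neq p_neq => e; rewrite -skip_del_block // e.
- by apply: (can_inj (skipK m)); rewrite !skip_del_block.
Qed.

Lemma noncrossing_del : noncrossing (del_block m s) <-> noncrossing s.
Proof.
split=> nc a b.
  move=> a_lt b_lt ab b_inside crossing.
  have a_neq : a != m by apply/eqP => e; move: b_inside; rewrite e sm; lia.
  have a_neq1 : a != m.+1 by apply/eqP => e; move: b_inside; rewrite e partner_adj; lia.
  have b_neq : b != m by apply/eqP => e; move: crossing; rewrite e sm; lia.
  have b_neq1 : b != m.+1 by apply/eqP => e; move: crossing; rewrite e partner_adj; lia.
  have aE := unskipK a_neq a_neq1; have bE := unskipK b_neq b_neq1.
  have ua_lt := unskip_lt ms a_lt a_neq a_neq1; have ub_lt := unskip_lt ms b_lt b_neq b_neq1.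
  apply: (nc (unskip m a) (unskip m b)); rewrite ?size_del_block //.
  - by rewrite -(skip_mono m) aE bE.
  - by rewrite -(skip_mono m) skip_del_block // aE bE.
  - by rewrite -(skip_mono m) !skip_del_block // aE bE.
rewrite size_del_block => a_lt b_lt ab b_inside crossing.
by apply: (nc (skip m a) (skip m b));
  rewrite ?(skip_lt ms) // -?skip_del_block // skip_mono.
Qed.

End DeleteBlock.

Section AdjacentBlocks.
Variable s : seq nat.
Hypotheses (sP : pairing s) (nc : noncrossing s).

Lemma exists_adj_block_inside a : a < size s -> a < nth 0 s a ->
  exists m, [/\ a <= m, m < nth 0 s a & nth 0 s m = m.+1].
Proof.
have [n] := ubnP (nth 0 s a - a); elim: n a => // n IH a len_lt a_lt opens.
have [adj|nadj] := eqVneq (nth 0 s a) a.+1; first by exists a; rewrite adj.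
have [pa_lt _ paK] := sP a_lt.
have b_lt : a.+1 < size s by lia.
have [pb_lt pb_neq pbK] := sP b_lt.
have pb_neq_pa : nth 0 s a.+1 != nth 0 s a by apply/eqP => e; move: pbK; rewrite e paK; lia.
have pb_neq_a : nth 0 s a.+1 != a by apply/eqP => e; move: pbK; rewrite e; lia.
have pb_lt_pa : nth 0 s a.+1 < nth 0 s a.
  by have := nc a_lt b_lt; lia.
have b_opens : a.+1 < nth 0 s a.+1.
  by have := nc pb_lt a_lt; rewrite pbK; lia.
have [|m [am mb sm]] := IH a.+1 _ b_lt b_opens; first lia.
by exists m; split=> //; lia.
Qed.

Lemma exists_adj_block : 2 < size s -> exists2 m, m.+2 < size s & nth 0 s m = m.+1.
Proof.
move=> s_gt2; have s_gt0 : 0 < size s by lia.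
have s_gt1 : 1 < size s by lia.
have [p0_lt p0_neq p0K] := sP s_gt0; have [p1_lt p1_neq p1K] := sP s_gt1.
have [p0_inside|p0_last] := ltnP (nth 0 s 0).+1 (size s).
  have [|m [_ m_lt sm]] := exists_adj_block_inside s_gt0; first lia.
  by exists m => //; lia.
have p1_neq0 : nth 0 s 1 != 0 by apply/eqP => e; move: p1K; rewrite e; lia.
have p1_neq_p0 : nth 0 s 1 != nth 0 s 0 by apply/eqP => e; move: p1K; rewrite e p0K.
have [|m [_ m_lt sm]] := exists_adj_block_inside s_gt1; first lia.
by exists m => //; lia.
Qed.

End AdjacentBlocks.

Lemma size_undup_cons_eqi (T : eqType) (x : T) (u v : seq T) :
  u =i x :: v -> size (undup u) = (x \notin v) + size (undup v).
Proof.
move=> uv; have -> : size (undup u) = size (undup (x :: v)).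
  by apply/perm_size/uniq_perm; rewrite ?undup_uniq // => y; rewrite !mem_undup.
by rewrite /=; case: (x \in v).
Qed.

Section Walks.
Variables (T : eqType) (x0 : T).
Implicit Types (g : seq T) (s : seq nat).

Definition edge g j := (nth x0 g j, nth x0 g (j.+1 %% size g)).

(* The two edges of each block are traversed in opposite directions: applied to [j] and to
   its partner, the condition says that one edge is the reversal of the other. *)
Definition folds s g := forall j, j < size s -> (edge g j).1 = (edge g (nth 0 s j)).2.

Lemma folds_edge_flip s g j : pairing s -> folds s g -> j < size s ->
  edge g (nth 0 s j) = ((edge g j).2, (edge g j).1).
Proof.
move=> sP gf js; have [p_lt _ pK] := sP _ js.
by rewrite (gf j js) [edge g _]surjective_pairing (gf _ p_lt) pK.
Qed.

Definition del_vertex m g := take m.+1 g ++ drop m.+3 g.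

Definition insert_vertex m v g := take m.+1 g ++ [:: v; nth x0 g m] ++ drop m.+1 g.

Section InsertVertex.
Variables (m : nat) (v : T) (g : seq T).
Hypothesis mg : m < size g.

Lemma size_insert_vertex : size (insert_vertex m v g) = (size g).+2.
Proof. by rewrite !size_cat size_drop size_takel //=; lia. Qed.

Lemma nth_insert_vertex : nth x0 (insert_vertex m v g) m.+1 = v.
Proof. by rewrite nth_cat size_takel // ltnn subnn. Qed.

Lemma nth_insert_vertex_fold :
  nth x0 (insert_vertex m v g) m = nth x0 (insert_vertex m v g) m.+2.
Proof.
rewrite !nth_cat size_takel // leqnn ltnNge leqnSn /= nth_take //.
by rewrite subSn // subnn.
Qed.

Lemma insert_vertexK : del_vertex m (insert_vertex m v g) = g.
Proof.
rewrite /del_vertex take_size_cat ?size_takel // drop_cat size_takel // ltnNge.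
by rewrite -[m.+3]addn2 leq_addr addKn /= drop0 cat_take_drop.
Qed.

End InsertVertex.

Section DeleteVertex.
Variables (m : nat) (g : seq T).
Hypothesis mg : m.+2 < size g.

Lemma size_del_vertex : size (del_vertex m g) = size g - 2.
Proof. by rewrite size_cat size_drop size_takel; lia. Qed.

Lemma nth_del_vertex j : nth x0 (del_vertex m g) j = nth x0 g (skip m.+1 j).
Proof.
rewrite nth_cat size_takel; last lia.
rewrite /skip; case: (ltnP j m.+1) => jm; first by rewrite nth_take.
by rewrite nth_drop (_ : m.+3 + (j - m.+1) = j.+2) //; lia.
Qed.

Hypothesis gm : nth x0 g m = nth x0 g m.+2.

Lemma edge_del j : j < size g - 2 -> edge (del_vertex m g) j = edge g (skip m j).
Proof.
move=> jg; rewrite /edge !nth_del_vertex size_del_vertex; congr pair.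
  rewrite /skip; have [->|jm] := eqVneq j m; first by rewrite ltnS leqnn ltnn.
  by congr (nth x0 g _); case: ifP; case: ifP; lia.
have [j_last|j_inner] := eqVneq j.+1 (size g - 2).
  rewrite -j_last modnn (_ : skip m j = j.+2); last by rewrite /skip; case: ifP; lia.
  by rewrite (_ : j.+3 = size g) ?modnn //; lia.
rewrite modn_small; last lia.
rewrite modn_small; last by rewrite /skip; case: ifP; lia.
by congr (nth x0 g _); rewrite /skip; case: ifP; case: ifP; lia.
Qed.

Lemma del_vertexP y :
  reflect (exists t, [/\ t < size g, t != m.+1 & nth x0 g t = y]) (y \in del_vertex m g).
Proof.
apply: (iffP (nthP x0)) => [[j]|[t [t_lt t_neq <-]]].
  rewrite size_del_vertex nth_del_vertex => js <-; exists (skip m.+1 j).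
  by have [? _] := skip_neq m.+1 j; split=> //; apply: skip_lt.
have [->|t_neq2] := eqVneq t m.+2.
  by exists m; rewrite ?size_del_vertex ?nth_del_vertex /skip ?ltnSn //; lia.
exists (unskip m.+1 t); first by rewrite size_del_vertex unskip_lt.
by rewrite nth_del_vertex unskipK.
Qed.

Lemma mem_del_vertex : g =i nth x0 g m.+1 :: del_vertex m g.
Proof.
move=> y; rewrite inE; apply/idP/predU1P => [/(nthP x0) [t t_lt <-]|[->|]].
- by have [->|t_neq] := eqVneq t m.+1; [left | right; apply/del_vertexP; exists t].
- by rewrite mem_nth // ltnW.
- by move=> /del_vertexP [t [t_lt _ <-]]; rewrite mem_nth.
Qed.

Lemma size_undup_del_vertex : size (undup g) =
  (nth x0 g m.+1 \notin del_vertex m g) + size (undup (del_vertex m g)).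
Proof. exact: size_undup_cons_eqi mem_del_vertex. Qed.

End DeleteVertex.

Section FoldedWalks.
Variables (m : nat) (s : seq nat) (g : seq T).
Hypotheses (sP : pairing s) (ms : m.+2 < size s) (sm : nth 0 s m = m.+1).
Hypothesis sg : size g = size s.

Let m1s : m.+1 < size s. Proof. exact: ltnW. Qed.
Let mg : m.+2 < size g. Proof. by rewrite sg. Qed.

Lemma folds_del :
  folds s g <-> nth x0 g m = nth x0 g m.+2 /\ folds (del_block m s) (del_vertex m g).
Proof.
have m_lt : m < size s by apply: ltnW.
have delP := pairing_del m1s sP sm.
have del_lt j (js : j < size s - 2) : nth 0 (del_block m s) j < size g - 2.
  by have [] := delP j; rewrite size_del_block // sg.
split=> [gf|[gm gf] j js].
  have gm : nth x0 g m = nth x0 g m.+2.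
    by have := gf m m_lt; rewrite sm /edge /= modn_small.
  split=> // j; rewrite size_del_block // => js.
  rewrite !edge_del ?sg ?del_lt // -?sg ?del_lt // skip_del_block //.
  by apply: gf; apply: skip_lt.
have [->|j_neq] := eqVneq j m; first by rewrite sm /edge /= modn_small.
have [->|j_neq1] := eqVneq j m.+1.
  by rewrite (partner_adj m1s sP sm) /edge /= modn_small // ltnW.
have uj_lt := unskip_lt m1s js j_neq j_neq1.
have := gf (unskip m j); rewrite size_del_block // => /(_ uj_lt).
by rewrite !edge_del ?sg ?del_lt // -?sg ?del_lt // skip_del_block // unskipK.
Qed.

End FoldedWalks.

Lemma folds_size_undup s g : pairing s -> noncrossing s -> 1 < size s ->
  size g = size s -> folds s g -> size (undup g) <= (size s)./2.+1.
Proof.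
have [n] := ubnP (size s); elim: n s g => // n IH s g s_lt sP nc s_gt1 sg gf.
have [s_le2|s_gt2] := leqP (size s) 2.
  by have := size_undup g; rewrite sg (_ : size s = 2) //; lia.
have [m ms sm] := exists_adj_block sP nc s_gt2.
have s_even := pairing_even sP.
have [gm del_gf] := (folds_del sP ms sm sg).1 gf.
have del_nc := (noncrossing_del (ltnW ms) sP sm).2 nc.
have := IH (del_block m s) (del_vertex m g) _ (pairing_del (ltnW ms) sP sm) del_nc _ _ del_gf.
rewrite size_del_block ?size_del_vertex ?(size_undup_del_vertex _ gm) ?sg //; last exact: ltnW.
by case: (_ \notin _) => /=; lia.
Qed.

Definition treelike s g :=
  [/\ size g = size s, folds s g & size (undup g) = (size s)./2.+1].

Lemma treelike_del m s g : pairing s -> noncrossing s -> m.+2 < size s ->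
  nth 0 s m = m.+1 -> size g = size s ->
  treelike s g <-> [/\ nth x0 g m = nth x0 g m.+2, nth x0 g m.+1 \notin del_vertex m g &
                       treelike (del_block m s) (del_vertex m g)].
Proof.
move=> sP nc ms sm sg; have ms1 := ltnW ms.
have delP := pairing_del ms1 sP sm.
have del_nc := (noncrossing_del ms1 sP sm).2 nc.
have sds : size (del_block m s) = size s - 2 by rewrite size_del_block.
have sdg : size (del_vertex m g) = size s - 2 by rewrite size_del_vertex ?sg.
have s_even := pairing_even sP.
split=> [[_ gf gV]|[gm fresh [_ del_gf del_gV]]].
  have [gm del_gf] := (folds_del sP ms sm sg).1 gf.
  have := folds_size_undup delP del_nc _ _ del_gf; rewrite sds sdg.
  have := size_undup_del_vertex (_ : m.+2 < size g) gm; rewrite gV sg => /(_ ms).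
  case: (boolP (_ \notin _)) => [fresh|_] /=; last by lia.
  by move=> gVE _; split=> //; split; rewrite ?sds ?sdg //; lia.
split=> //; first exact/(folds_del sP ms sm sg).
by rewrite (size_undup_del_vertex _ gm) ?sg // fresh del_gV sds; lia.
Qed.

End Walks.

Lemma treelike2 (g : seq nat) : size g = 2 -> treelike 0 [:: 1; 0] g <-> nth 0 g 0 <> nth 0 g 1.
Proof.
case: g => [//|a [//|b [|//]]] _; rewrite /treelike /= mem_seq1.
split=> [[_ _]|/eqP/negbTE->]; first by case: eqP.
by split=> // -[|[|//]].
Qed.

Lemma adoptedF_treelike fuel s g : pairing s -> noncrossing s -> 1 < size s ->
  size s <= fuel -> size g = size s -> adoptedF fuel s g <-> treelike 0 s g.
Proof.
elim: fuel s g => [|fuel IH] s g sP nc s_gt1 s_le sg; first lia.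
rewrite /=; case: eqVneq => [s2|s_neq2].
  by rewrite (pairing2 sP s2) treelike2 // sg s2.
have s_gt2 : 2 < size s by rewrite ltn_neqAle eq_sym s_neq2.
have s_even := pairing_even sP.
have del_adopted m (ms : m.+2 < size s) (sm : nth 0 s m = m.+1) :
    adoptedF fuel (del_block m s) (del_vertex m g) <->
    treelike 0 (del_block m s) (del_vertex m g).
  have ms1 := ltnW ms.
  apply: IH; rewrite ?size_del_block ?size_del_vertex ?sg //; try lia.
  - exact: pairing_del.
  - exact/noncrossing_del.
split=> [g_adopted|gT m ms sm].
  have [m ms sm] := exists_adj_block sP nc s_gt2.
  have mg : m.+2 < size g by rewrite sg.
  have [gm fresh /(del_adopted m ms sm) delT] := g_adopted m ms sm.
  apply/(treelike_del 0 sP nc ms sm sg); split=> //.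
  apply/negP => /(del_vertexP mg gm) [t [t_lt t_neq /esym]].
  by apply: fresh; [rewrite -sg | exact/eqP].
have [gm fresh delT] := (treelike_del 0 sP nc ms sm sg).1 gT.
split=> //; last exact/(del_adopted m ms sm).
move=> t t_lt t_neq gt; move/negP: fresh; apply.
have mg : m.+2 < size g by rewrite sg.
by apply/(del_vertexP mg gm); exists t; rewrite sg; split=> //; exact/eqP.
Qed.

Lemma exists_treelike s : pairing s -> noncrossing s -> 1 < size s ->
  exists g : seq nat, treelike 0 s g.
Proof.
have [n] := ubnP (size s); elim: n s => // n IH s s_lt sP nc s_gt1.
have [s_le2|s_gt2] := leqP (size s) 2.
  have /(pairing2 sP) -> : size s = 2 by lia.
  by exists [:: 0; 1]; apply/treelike2.
have [m ms sm] := exists_adj_block sP nc s_gt2; have ms1 := ltnW ms.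
have s_even := pairing_even sP.
have sds := size_del_block ms1.
have [|||g gT] := IH (del_block m s) _ (pairing_del ms1 sP sm); rewrite ?sds; try lia.
  exact/noncrossing_del.
have sg : size g = size s - 2 by case: gT => ->.
have mg : m < size g by lia.
pose v := (\max_(x <- g) x).+1.
have fresh : v \notin g.
  by apply/negP => /(@leq_bigmax_seq _ g xpredT id v) /(_ isT); rewrite ltnn.
exists (insert_vertex 0 m v g).
apply/(treelike_del 0 sP nc ms sm); first by rewrite size_insert_vertex // sg; lia.
by rewrite nth_insert_vertex // insert_vertexK // nth_insert_vertex_fold.
Qed.

Lemma Gseq_treelike s : pairing s -> noncrossing s -> 1 < size s -> treelike 0 s (Gseq s).
Proof.
move=> sP nc s_gt1; have [g gT] := exists_treelike sP nc s_gt1.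
have : adopted s (Gseq s).
  apply: ClassicalEpsilon.epsilon_spec; exists g; split; first by case: gT.
  by apply/adoptedF_treelike => //; case: gT.
by case=> sG /(adoptedF_treelike sP nc s_gt1 (leqnn _) sG).
Qed.

(* The walk of pairs (g_j, i_j) folds too, so it has no more vertices than g. *)
Lemma treelike_factor (T : eqType) (x0 : T) s (g : seq nat) (i : seq T) a b :
  pairing s -> noncrossing s -> 1 < size s -> treelike 0 s g ->
  size i = size s -> folds x0 s i -> a < size s -> b < size s ->
  nth 0 g a = nth 0 g b -> nth x0 i a = nth x0 i b.
Proof.
move=> sP nc s_gt1 [sg gf gV] si fi a_lt b_lt gab.
pose z := zip g i; have sgi : size g = size i by rewrite sg si.
have sz : size z = size s by rewrite size_zip sg si minnn.
have zf : folds (0, x0) s z.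
  move=> j js; have := gf j js; have := fi j js.
  by rewrite /edge sz sg si /= !nth_zip // => -> ->.
have z_vertices := folds_size_undup sP nc s_gt1 sz zf.
have fst_sub : {subset undup g <= [seq x.1 | x <- undup z]}.
  move=> y; rewrite mem_undup => /(nthP 0) [j jg <-]; apply/mapP.
  exists (nth (0, x0) z j); last by rewrite nth_zip.
  by rewrite mem_undup mem_nth // sz -sg.
have fst_uniq : uniq [seq x.1 | x <- undup z].
  by apply: (leq_size_uniq (undup_uniq g) fst_sub); rewrite size_map gV.
have mem_z c : c < size s -> (nth 0 g c, nth x0 i c) \in undup z.
  by move=> c_lt; rewrite mem_undup -nth_zip // mem_nth ?sz.
suff : (nth 0 g a, nth x0 i a) = (nth 0 g b, nth x0 i b) by case.
rewrite -(nth_index (0, x0) (mem_z a a_lt)) -(nth_index (0, x0) (mem_z b b_lt)); congr nth.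
apply/eqP; rewrite -(nth_uniq 0 _ _ fst_uniq) ?size_map ?index_mem ?mem_z //.
by rewrite !(nth_map (0, x0)) ?index_mem ?nth_index ?mem_z //=; apply/eqP.
Qed.

Definition uedge (g : seq nat) j :=
  (minn (edge 0 g j).1 (edge 0 g j).2, maxn (edge 0 g j).1 (edge 0 g j).2).

Definition loopless (e : nat * nat) := e.1 != e.2.

Lemma edgesE g : edges g = undup [seq uedge g j | j <- iota 0 (size g)].
Proof. by []. Qed.

(* A walk is connected: every vertex it discovers comes with a new edge. *)
Lemma walk_vertices_le (g : seq nat) n : n < size g ->
  size (undup (take n.+1 g)) <=
  (size (undup [seq e <- [seq uedge g j | j <- iota 0 n] | loopless e])).+1.
Proof.
elim: n => [|n IH] n_lt; first by case: g n_lt => // x g _; rewrite /= take0.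
have {}IH := IH (ltnW n_lt).
rewrite (take_nth 0) // -[in iota 0 n.+1]addn1 iotaD map_cat filter_cat /= add0n.
set W := take n.+1 g in IH *; set v := nth 0 g n.+1.
set E := [seq e <- _ | _] in IH *.
have visited t : t <= n -> nth 0 g t \in W.
  by move=> tn; rewrite -[nth 0 g t](@nth_take n.+1) // mem_nth // size_takel // ltnW.
have uedge_lt t : t <= n ->
    uedge g t = (minn (nth 0 g t) (nth 0 g t.+1), maxn (nth 0 g t) (nth 0 g t.+1)).
  by move=> tn; rewrite /uedge /edge /= modn_small //; lia.
have -> : size (undup (rcons W v)) = (v \notin W) + size (undup W).
  by apply: size_undup_cons_eqi => y; rewrite mem_rcons.
have [vW|v_new] /= := boolP (v \in W).
  rewrite add0n (leq_trans IH) // ltnS uniq_leq_size ?undup_uniq // => e.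
  by rewrite !mem_undup mem_cat => ->.
have e_loopless : loopless (uedge g n).
  have : nth 0 g n != v by apply: contraNneq v_new => <-; rewrite visited.
  by rewrite uedge_lt // /loopless /=; lia.
have e_new : uedge g n \notin E.
  apply/negP; rewrite mem_filter => /andP [_ /mapP [t]]; rewrite mem_iota => /= t_lt.
  rewrite !uedge_lt // ?(ltnW t_lt) // => -[min_eq max_eq].
  have [v_eq|v_eq] : v = nth 0 g t \/ v = nth 0 g t.+1 by rewrite /v; lia.
    by move: v_new; rewrite v_eq visited // ltnW.
  by move: v_new; rewrite v_eq visited.
rewrite e_loopless.
have -> : size (undup (E ++ [:: uedge g n])) = (uedge g n \notin E) + size (undup E).
  by apply: size_undup_cons_eqi => e; rewrite mem_cat mem_seq1 inE orbC.
by rewrite e_new !add1n ltnS.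
Qed.

Section TreelikeEdges.
Variables (s g : seq nat).
Hypotheses (sP : pairing s) (s_gt1 : 1 < size s) (gT : treelike 0 s g).

Let openers := [seq j <- iota 0 (size s) | j < nth 0 s j].

Let sg : size g = size s. Proof. by case: gT. Qed.

Let openers_edges : [seq uedge g j | j <- openers] =i edges g.
Proof.
have [_ gf _] := gT.
move=> e; rewrite edgesE mem_undup sg; apply/mapP/mapP => [[j]|[j]].
  by rewrite mem_filter => /andP [_ js] ->; exists j.
rewrite mem_iota => /= js ->; have [p_lt p_neq pK] := sP js.
have [j_opens|j_closes] := ltnP j (nth 0 s j).
  by exists j => //; rewrite mem_filter j_opens mem_iota.
exists (nth 0 s j); first by rewrite mem_filter pK mem_iota p_lt ltn_neqAle p_neq j_closes.
by rewrite /uedge (folds_edge_flip sP gf) //= minnC maxnC.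
Qed.

Let size_openers_le : size openers <= size [seq e <- edges g | loopless e].
Proof.
have [_ _ gV] := gT; have g_gt0 : 0 < size g by rewrite sg ltnW.
rewrite (size_filter _ (iota _ _)) -[leqLHS]doubleK (count_lt_involution sP) -ltnS -gV.
have := @walk_vertices_le g (size g).-1; rewrite prednK // take_size => /(_ (leqnn _)).
move=> /leq_trans; apply; rewrite ltnS; apply: uniq_leq_size; first exact: undup_uniq.
move=> e; rewrite mem_undup !mem_filter edgesE mem_undup => /andP [-> /mapP [j]] /=.
rewrite mem_iota => /= j_lt ->; apply: map_f.
by rewrite mem_iota (leq_trans j_lt) // leq_pred.
Qed.

Lemma perm_openers_edges : perm_eq [seq uedge g j | j <- openers] (edges g).
Proof.
have edges_uniq : uniq (edges g) by rewrite edgesE undup_uniq.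
apply: uniq_perm => //; apply: (leq_size_uniq edges_uniq) => [e|]; first by rewrite openers_edges.
by rewrite size_map (leq_trans size_openers_le) // size_filter count_size.
Qed.

Lemma treelike_loopless e : e \in edges g -> loopless e.
Proof.
have : all loopless (edges g); last by move=> /allP edgesP /edgesP.
rewrite all_count eqn_leq count_size -size_filter (leq_trans _ size_openers_le) //.
by rewrite -(perm_size perm_openers_edges) size_map.
Qed.

End TreelikeEdges.

Section PairPartitions.
Variables (k : nat) (p : {ffun 'I_k -> 'I_k}).

Definition is_pairing : bool := [forall i, (p i != i) && (p (p i) == i)].

Lemma is_pairingP : reflect (forall j, p j != j /\ p (p j) = j) is_pairing.
Proof.
apply: (iffP forallP) => pP j; first by have /andP [p_neq /eqP] := pP j.
by have [p_neq ->] := pP j; rewrite p_neq eqxx.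
Qed.

Lemma size_ppseq : size (ppseq p) = k.
Proof. by rewrite size_map size_enum_ord. Qed.

Lemma nth_ppseq (j : 'I_k) : nth 0 (ppseq p) j = p j.
Proof. by rewrite (nth_map j) ?size_enum_ord // nth_ord_enum. Qed.

Lemma pairing_ppseq : is_pairing -> pairing (ppseq p).
Proof.
move=> /is_pairingP pP j; rewrite size_ppseq => jk; have [p_neq pK] := pP (Ordinal jk).
by rewrite (nth_ppseq (Ordinal jk)) nth_ppseq pK.
Qed.

Lemma is_ncppP : is_ncpp p <-> is_pairing /\ noncrossing (ppseq p).
Proof.
split=> [/andP [pP nc]|[pP nc]].
  split=> // a b; rewrite size_ppseq => ak bk ab.
  rewrite (nth_ppseq (Ordinal ak)) (nth_ppseq (Ordinal bk)) => b_inside crossing.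
  move/existsPn: nc => /(_ (Ordinal ak)) /existsPn /(_ (Ordinal bk)).
  by rewrite /= ab b_inside crossing.
apply/andP; split=> //.
apply/negP => /existsP [a /existsP [b /andP [/andP [ab b_inside] crossing]]].
by apply: (nc a b); rewrite ?size_ppseq ?nth_ppseq.
Qed.

Lemma is_ncpp_even : is_ncpp p -> ~~ odd k.
Proof. by move=> /is_ncppP [/pairing_ppseq/pairing_even + _]; rewrite size_ppseq. Qed.

End PairPartitions.

(** * Counting tuples with prescribed edge equivalences *)

Lemma card_le_fibers (T T' : finType) (A : {set T}) (f : T -> T') K :
  (forall y, y \in f @: A -> #|[set x in A | f x == y]| <= K) ->
  #|A| <= K * #|f @: A|.
Proof.
move=> fK; rewrite -sum1_card (partition_big f [in f @: A]) /= => [|x xA]; last exact: imset_f.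
rewrite mulnC -sum_nat_const; apply: leq_sum => y yA.
rewrite (leq_trans _ (fK y yA)) // -sum1_card; apply: eq_leq; apply: eq_bigl => x.
by rewrite inE.
Qed.

Section EquivalenceRel.
Variables (T : Type) (r : rel T).
Hypothesis r_equiv : equivalence_rel r.

Lemma equivalence_rel_refl : reflexive r.
Proof. by move=> x; have [] := r_equiv x x x. Qed.

Lemma equivalence_rel_left_trans : left_transitive r.
Proof. by move=> x y xy z; have [_ /(_ xy)] := r_equiv x y z. Qed.

Lemma equivalence_rel_sym : symmetric r.
Proof.
by move=> x y; apply/idP/idP => /equivalence_rel_left_trans <-; exact: equivalence_rel_refl.
Qed.

Lemma equivalence_rel_trans : transitive r.
Proof. by move=> y x z /equivalence_rel_left_trans <-. Qed.

End EquivalenceRel.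

Section Windows.
Variables (N k : nat) (x0 : 'I_N) (a : nat).
Implicit Types (v : k.-tuple 'I_N) (D : {set k.-tuple 'I_N}).

Definition visit v y := nth x0 v (y %% k).

Definition window t v : t.+1.-tuple 'I_N := [tuple visit v (a + x) | x < t.+1].

Lemma nth_window t v x : x <= t -> nth x0 (window t v) x = visit v (a + x).
Proof. by move=> xt; rewrite (nth_mktuple _ _ (Ordinal (xt : x < t.+1))). Qed.

Lemma edge_visit v y : edge x0 v (y %% k) = (visit v y, visit v y.+1).
Proof. by rewrite /edge size_tuple /visit -addn1 modnDml addn1. Qed.

Lemma card_window_step D t K (S : t.+1.-tuple 'I_N -> {set 'I_N}) :
  (forall v, v \in D -> visit v (a + t.+1) \in S (window t v)) ->
  (forall w, #|S w| <= K) ->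
  #|window t.+1 @: D| <= K * #|window t @: D|.
Proof.
move=> DS SK; pose front (w : t.+2.-tuple 'I_N) := [tuple nth x0 w x | x < t.+1].
have front_window v : front (window t.+1 v) = window t v.
  by apply: eq_from_tnth => x; rewrite !tnth_mktuple nth_window // ltnW.
have <- : front @: (window t.+1 @: D) = window t @: D.
  by rewrite -imset_comp; apply: eq_imset.
apply: card_le_fibers => y _; rewrite (leq_trans _ (SK y)) //.
pose last_vertex (w : t.+2.-tuple 'I_N) := nth x0 w t.+1.
rewrite -(card_in_imset (f := last_vertex)) => [|w w']; last first.
  rewrite !inE => /andP [_ /eqP wy] /andP [_ /eqP wy'] last_eq.
  apply: val_inj; apply: (@eq_from_nth _ x0); rewrite !size_tuple // => x.
  rewrite ltnS leq_eqVlt => /predU1P [->//|xt].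
  have : tnth (front w) (Ordinal xt) = tnth (front w') (Ordinal xt) by rewrite wy wy'.
  by rewrite !tnth_mktuple.
apply: subset_leq_card; apply/fintype.subsetP => z /imsetP [w].
rewrite inE => /andP [/imsetP [v vD ->]]; rewrite front_window => /eqP <- ->.
by rewrite /last_vertex nth_window // DS.
Qed.

Lemma card_window_free D t : #|window t.+1 @: D| <= N * #|window t @: D|.
Proof.
apply: (card_window_step (S := fun=> [set: 'I_N])) => [v _|w]; first by rewrite inE.
by rewrite cardsT card_ord.
Qed.

Hypothesis k_gt0 : 0 < k.

Lemma card_full_window D : #|D| <= #|window k.-1 @: D|.
Proof.
rewrite card_in_imset // => v v' _ _ window_eq.
apply: val_inj; apply: (@eq_from_nth _ x0); rewrite !size_tuple // => y yk.
pose x := (y + (k - a %% k)) %% k.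
have xk : x <= k.-1 by rewrite -ltnS prednK // ltn_mod.
have := congr1 (fun w => nth x0 (tval w) x) window_eq; rewrite !nth_window // /visit.
suff -> : (a + x) %% k = y by [].
have ak : a %% k <= k by rewrite ltnW // ltn_mod.
by rewrite /x modnDmr addnCA -modnDmr -(modnDml a) subnKC // modnn addn0 modn_small.
Qed.

Variables (r : rel ('I_N * 'I_N)) (B : nat).
Hypothesis r_fibers : forall p q q' : 'I_N, #|[set s | r (p, q) (q', s)]| <= B.
Hypothesis B_gt0 : 0 < B.

Definition linked_to_earlier D t := exists2 x, x < t &
  forall v, v \in D -> r (edge x0 v ((a + x) %% k)) (edge x0 v ((a + t) %% k)).

Lemma card_window_linked D t : linked_to_earlier D t ->
  #|window t.+1 @: D| <= B * #|window t @: D|.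
Proof.
move=> [x xt Dr]; apply: (card_window_step (S := fun w =>
  [set s | r (nth x0 w x, nth x0 w x.+1) (nth x0 w t, s)])) => [v vD|w]; last exact: r_fibers.
by rewrite inE !nth_window ?(ltnW xt) //; have := Dr v vD; rewrite !edge_visit !addnS.
Qed.

Lemma card_window_walk D (free : pred nat) t0 n :
  (forall t, t0 <= t -> t < t0 + n -> ~~ free t -> linked_to_earlier D t) ->
  #|window (t0 + n) @: D| <= #|window t0 @: D| * N ^ count free (iota t0 n) * B ^ n.
Proof.
elim: n => [|n IH] linked; first by rewrite addn0 !muln1.
have {}IH := IH (fun t ge lt => linked t ge (leq_trans lt (leq_add (leqnn _) (leqnSn _)))).
rewrite addnS -[in iota _ _]addn1 iotaD count_cat /= addn0.
have [_|bound] := boolP (free (t0 + n)).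
  rewrite (leq_trans (card_window_free _ _)) // (leq_trans (leq_mul (leqnn N) IH)) //.
  by rewrite addn1 expnS mulnA leq_mul ?leq_pexp2l // mulnCA.
have {}linked : linked_to_earlier D (t0 + n) by apply: linked; lia.
rewrite (leq_trans (card_window_linked linked)) //.
by rewrite (leq_trans (leq_mul (leqnn B) IH)) // addn0 mulnCA -expnS.
Qed.

Lemma card_walk D (free : pred nat) t0 : t0 < k ->
  (forall t, t0 <= t -> t < k.-1 -> ~~ free t -> linked_to_earlier D t) ->
  #|D| <= #|window t0 @: D| * N ^ count free (iota t0 (k.-1 - t0)) * B ^ k.
Proof.
move=> t0k linked; apply: (leq_trans (card_full_window D)).
have t0E : t0 + (k.-1 - t0) = k.-1 by lia.
have := @card_window_walk D free t0 (k.-1 - t0); rewrite t0E => /(_ linked) /leq_trans.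
by apply; rewrite leq_mul2l leq_pexp2l ?orbT //; lia.
Qed.

End Windows.

Section RotatedPairing.
Variables (s : seq nat) (a : nat).
Hypotheses (sP : pairing s) (a_lt : a < size s).

(* The pairing as seen from position [a], so that a walk may start at any block. *)
Definition rpartner t := (nth 0 s ((a + t) %% size s) + (size s - a)) %% size s.

Let s_gt0 : 0 < size s. Proof. exact: leq_ltn_trans a_lt. Qed.

Lemma rpartner_shift t : (a + rpartner t) %% size s = nth 0 s ((a + t) %% size s).
Proof.
rewrite /rpartner modnDmr addnCA subnKC ?(ltnW a_lt) // modnDr modn_small //.
by case: (sP (ltn_pmod (a + t) s_gt0)).
Qed.

Lemma rpartner_involution : fixfree_involution (size s) rpartner.
Proof.
move=> t ts; split; first by rewrite ltn_mod.
- have [_ + _] := sP (ltn_pmod (a + t) s_gt0).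
  by apply: contra_neq => tt; rewrite -rpartner_shift tt.
- rewrite {1}/rpartner rpartner_shift.
  have [_ _ ->] := sP (ltn_pmod (a + t) s_gt0).
  by rewrite modnDml addnAC subnKC ?(ltnW a_lt) // addnC modnDr modn_small.
Qed.

Lemma rpartner_right t : a + t < size s -> a <= nth 0 s (a + t) ->
  rpartner t = nth 0 s (a + t) - a.
Proof.
move=> at_lt at_ge; have [p_lt _ _] := sP at_lt; rewrite /rpartner (modn_small at_lt).
by rewrite addnBA ?(ltnW a_lt) // addnC -addnBA // modnDl modn_small //; lia.
Qed.

Lemma rpartner_left t : a + t < size s -> nth 0 s (a + t) < a ->
  rpartner t = nth 0 s (a + t) + (size s - a).
Proof. by move=> at_lt p_lt; rewrite /rpartner !modn_small //; lia. Qed.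

End RotatedPairing.

Definition nonadjacent (s : seq nat) := forall m, m.+2 < size s -> nth 0 s m <> m.+1.

Lemma exists_shortest_block s : pairing s -> 2 < size s -> nonadjacent s ->
  exists m l, [/\ 1 < l, m + l < size s, nth 0 s m = m + l &
    forall t, 0 < t -> t < l -> nth 0 s (m + t) < m \/ m + l < nth 0 s (m + t)].
Proof.
move=> sP s_gt2 nadj.
pose is_length l := (1 < l) && [exists m : 'I_(size s), nth 0 s m == m + l].
have is_lengthP y l : y < size s -> 1 < l -> nth 0 s y = y + l -> is_length l.
  by move=> ys l_gt1 yl; rewrite /is_length l_gt1; apply/existsP; exists (Ordinal ys); apply/eqP.
have lengths : exists l, is_length l.
  have s_gt0 : 0 < size s by lia.
  have [_ p0_neq _] := sP _ s_gt0; have := nadj 0 s_gt2.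
  by exists (nth 0 s 0); apply: (is_lengthP 0) => //; lia.
case: (ex_minnP lengths) => l /andP [l_gt1 /existsP [[m ms] /= /eqP sm]] l_min.
have [p_lt _ pK] := sP m ms; rewrite sm in p_lt pK.
exists m, l; split=> // t t_gt0 tl.
have no_inner y l' : 0 < l' -> m < y -> y + l' < m + l -> nth 0 s y <> y + l'.
  move=> l'_gt0 my yl' e; have [l'1|l'_neq1] := eqVneq l' 1.
    by apply: (nadj y); rewrite ?e ?l'1; lia.
  by have : is_length l' by [apply: (is_lengthP y); lia]; move=> /l_min; lia.
have y_lt : m + t < size s by lia.
have [z_lt z_neq zK] := sP (m + t) y_lt.
set z := nth 0 s (m + t) in z_lt z_neq zK *.
have z_neq_m : z != m by apply/eqP => e; move: zK; rewrite e sm; lia.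
have z_neq_ml : z != m + l by apply/eqP => e; move: zK; rewrite e pK; lia.
have := no_inner (m + t) (z - (m + t)); have := no_inner z (m + t - z).
by rewrite zK -/z; lia.
Qed.

Section CountLinked.
Variables (N : nat) (x0 : 'I_N) (r : rel ('I_N * 'I_N)) (B : nat).
Hypothesis r_equiv : equivalence_rel r.
Hypothesis r_fibers : forall p q q' : 'I_N, #|[set s | r (p, q) (q', s)]| <= B.

Let r_sym := equivalence_rel_sym r_equiv.

Let N_gt0 : 0 < N. Proof. exact: leq_ltn_trans (ltn_ord x0). Qed.

Let B_gt0 : 0 < B.
Proof.
apply: leq_trans (r_fibers x0 x0 x0); apply/card_gt0P.
by exists x0; rewrite inE (equivalence_rel_refl r_equiv).
Qed.

Section Patterns.
Variables (k : nat) (i : k.-tuple 'I_N).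

Definition edge_class (j : 'I_k) : {set 'I_k} := [set l : 'I_k | r (edge x0 i j) (edge x0 i l)].

(* Sends a position to the first one with an equivalent edge; fixed points count classes. *)
Definition pattern : {ffun 'I_k -> 'I_k} :=
  [ffun j : 'I_k => [arg min_(l < j in edge_class j) val l]].

Definition nclasses := #|[pred j | pattern j == j]|.

Lemma mem_edge_class j : j \in edge_class j.
Proof. by rewrite inE equivalence_rel_refl. Qed.

Lemma patternP j : [/\ pattern j \in edge_class j, pattern j <= j &
  forall l : 'I_k, l \in edge_class j -> pattern j <= l].
Proof.
rewrite /pattern ffunE; case: arg_minnP; first exact: mem_edge_class.
by move=> l l_in l_min; split=> //; apply: l_min; exact: mem_edge_class.
Qed.

Lemma eq_edge_class j l : l \in edge_class j -> edge_class l = edge_class j.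
Proof.
rewrite inE => /(equivalence_rel_left_trans r_equiv) jl.
by apply/finset.setP => y; rewrite !inE jl.
Qed.

Lemma pattern_eq j l : (pattern j == pattern l) = (l \in edge_class j).
Proof.
apply/eqP/idP => [jl|lj].
  have [+ _ _] := patternP l; have [+ _ _] := patternP j; rewrite -jl.
  by move=> /eq_edge_class <- /eq_edge_class ->; exact: mem_edge_class.
have jl := eq_edge_class lj; have [pj_in _ pj_min] := patternP j.
have [pl_in _ pl_min] := patternP l; rewrite jl in pl_in pl_min.
by apply: val_inj; apply/eqP; rewrite eqn_leq pj_min //= pl_min.
Qed.

Lemma pattern_idem j : pattern (pattern j) = pattern j.
Proof. by apply/eqP; rewrite eq_sym pattern_eq; case: (patternP j). Qed.

Lemma sum_edge_class : \sum_(j | pattern j == j) #|edge_class j| = k.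
Proof.
transitivity (\sum_(l < k) 1); last by rewrite sum1_card card_ord.
rewrite [RHS](partition_big pattern (fun j => pattern j == j)) /= => [|j _]; last first.
  by rewrite pattern_idem.
apply: eq_bigr => j /eqP jE; rewrite -sum1_card; apply: eq_bigl => l.
by rewrite -pattern_eq jE eq_sym.
Qed.

Lemma card_edge_class_two : (forall j, 1 < #|edge_class j|) -> k <= nclasses.*2 ->
  forall j, #|edge_class j| = 2.
Proof.
move=> classes_gt1 many j.
have [pj_in _ _] := patternP j; rewrite -(eq_edge_class pj_in).
have pj_fix : pattern (pattern j) == pattern j by rewrite pattern_idem.
apply/eqP; rewrite eqn_leq classes_gt1 andbT leqNgt; apply/negP => big_class.
suff : nclasses.*2 < k by rewrite ltnNge many.
rewrite -[ltnRHS]sum_edge_class -muln2 -sum_nat_const (bigD1 (pattern j)) //=.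
rewrite [ltnRHS](bigD1 (pattern j)) //= -addSn leq_add //.
by apply: leq_sum => l _; exact: classes_gt1.
Qed.

Lemma exists_pairing_of_classes : (forall j, 1 < #|edge_class j|) -> k <= nclasses.*2 ->
  exists2 p : {ffun 'I_k -> 'I_k}, is_pairing p & forall j, edge_class j = [set j; p j].
Proof.
move=> classes_gt1 many.
have /choice [p pP] : forall j, exists l, l != j /\ edge_class j = [set j; l].
  move=> j.
  have /eqP/cards2P [x [y [xy classE]]] := card_edge_class_two classes_gt1 many j.
  have : j \in [set x; y] by rewrite -classE mem_edge_class.
  rewrite !inE classE => /orP [] /eqP ->; first by exists y; rewrite eq_sym.
  by exists x; rewrite finset.setUC.
exists [ffun j => p j] => [|j]; last by rewrite ffunE; case: (pP j).
apply/is_pairingP => j; rewrite !ffunE; have [p_neq classE] := pP j; split=> //.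
have pj_in : p j \in edge_class j by rewrite classE !inE eqxx orbT.
have : j \in edge_class (p j) by rewrite (eq_edge_class pj_in) mem_edge_class.
by have [_ ->] := pP (p j); rewrite !inE eq_sym (negbTE p_neq) => /eqP.
Qed.

End Patterns.

Lemma card_pattern k (f : {ffun 'I_k -> 'I_k}) : 0 < k ->
  #|[set i : k.-tuple 'I_N | pattern i == f]| <= N ^ (#|[pred j | f j == j]|).+1 * B ^ k.
Proof.
move=> k_gt0; set D := [set i | _].
have [->|[i0 i0D]] := set_0Vmem D; first by rewrite cards0.
have DE i : i \in D -> f = pattern i by rewrite inE => /eqP.
pose free t := if insub t is Some j then f j == j else true.
have linked t : t < k.-1 -> ~~ free t -> linked_to_earlier x0 0 r D t.
  move=> t_lt; have tk : t < k by rewrite (leq_trans t_lt) // leq_pred.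
  rewrite /free insubT => f_neq; exists (f (Ordinal tk)).
    have [_ f_le _] := patternP i0 (Ordinal tk); rewrite -(DE i0) // in f_le.
    by rewrite ltn_neqAle f_neq.
  move=> i iD; rewrite !add0n !modn_small // (DE i) //.
  by have [+ _ _] := patternP i (Ordinal tk); rewrite inE r_sym.
have := card_walk k_gt0 r_fibers B_gt0 k_gt0 (fun t _ => @linked t).
rewrite subn0 => /leq_trans; apply.
rewrite leq_mul2r expnS; apply/orP; right; apply: leq_mul.
  by rewrite (leq_trans (max_card _)) // card_tuple card_ord expn1.
rewrite leq_pexp2l // (@leq_trans (count free (iota 0 k))) //.
  by rewrite -[in leqRHS](subnKC (leq_pred k)) iotaD count_cat leq_addr.
rewrite -sum1_count -sum1_card -[in iota _ _](subn0 k) -/(index_iota _ _) big_mkord.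
by apply: eq_leq; apply: eq_bigl => j; rewrite /free valK.
Qed.

Lemma card_few_classes k : 0 < k ->
  #|[set i : k.-tuple 'I_N | (nclasses i).*2 < k]| <= k ^ k * N ^ (k.+1)./2 * B ^ k.
Proof.
move=> k_gt0; set A := [set _ | _].
have patterns_le : #|[set pattern i | i in A]| <= k ^ k.
  by rewrite (leq_trans (max_card _)) // card_ffun !card_ord.
rewrite -mulnA mulnC; apply: (leq_trans _ (leq_mul (leqnn _) patterns_le)).
apply: card_le_fibers => f /imsetP [i0]; rewrite inE => few fE.
apply: (@leq_trans #|[set i : k.-tuple 'I_N | pattern i == f]|).
  by apply: subset_leq_card; apply/fintype.subsetP => i; rewrite !inE => /andP [].
apply: (leq_trans (card_pattern f k_gt0)); rewrite leq_mul2r leq_pexp2l ?orbT //.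
by move: few; rewrite /nclasses fE; lia.
Qed.

Definition linked (s : seq nat) (i : seq 'I_N) : Prop := forall j, j < size s ->
  r (edge x0 i j) (edge x0 i (nth 0 s j)).

Lemma card_linked_walk s (D : {set (size s).-tuple 'I_N}) a t0 :
  pairing s -> a < size s -> t0 < size s -> (forall i, i \in D -> linked s i) ->
  #|D| * N ^ count (fun t => t < rpartner s a t) (iota 0 t0)
    <= #|window x0 a t0 @: D| * N ^ (size s)./2 * B ^ size s.
Proof.
move=> sP a_lt t0_lt DL; set free := fun t => t < rpartner s a t.
have s_gt0 : 0 < size s by exact: leq_ltn_trans a_lt.
have freeP t : t < (size s).-1 -> ~~ free t -> linked_to_earlier x0 a r D t.
  move=> t_lt bound; have t_lt' : t < size s by rewrite (leq_trans t_lt) // leq_pred.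
  have [_ p_neq _] := rpartner_involution sP a_lt t_lt'.
  exists (rpartner s a t); first by rewrite ltn_neqAle p_neq leqNgt.
  by move=> v /DL vL; rewrite r_sym rpartner_shift //; apply/vL/ltn_pmod.
have card_D := card_walk s_gt0 r_fibers B_gt0 t0_lt (fun t _ => @freeP t).
have free_total : count free (iota 0 (size s)) = (size s)./2.
  by rewrite -[in RHS](count_lt_involution (rpartner_involution sP a_lt)) doubleK.
have free_le : count free (iota 0 t0) + count free (iota t0 ((size s).-1 - t0)) <= (size s)./2.
  rewrite -count_cat -{2}[t0]add0n -iotaD -free_total.
  have : t0 + ((size s).-1 - t0) <= size s by lia.
  by move: (t0 + _) => n /subnKC <-; rewrite iotaD count_cat leq_addr.
apply: (leq_trans (leq_mul card_D (leqnn _))).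
rewrite mulnAC leq_mul2r -mulnA -expnD leq_mul2l leq_pexp2l ?orbT //.
by rewrite addnC.
Qed.

Definition max_vertex_equiv := \max_(p : 'I_N)
  #|[set t : 'I_N * 'I_N * 'I_N | r (p, t.1.1) (t.1.2, t.2)]|.

Definition open_corners := #|[set t : 'I_N * 'I_N * 'I_N |
  r (t.1.1, t.1.2) (t.1.2, t.2) && (t.2 != t.1.1)]|.

Lemma card_linked_open_corner s m : pairing s -> m.+2 < size s -> nth 0 s m = m.+1 ->
  #|[set i : (size s).-tuple 'I_N | `[< linked s i >] && (nth x0 i m != nth x0 i m.+2)]| * N
    <= open_corners * N ^ (size s)./2 * B ^ size s.
Proof.
move=> sP ms sm; set D := [set i | _].
have ms1 := ltnW ms; have m_lt := ltnW ms1.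
have DL (i : (size s).-tuple 'I_N) : i \in D -> linked s i.
  by rewrite inE => /andP [/asboolP].
have s_gt2 : 2 < size s by lia.
have pm1 : nth 0 s (m + 1) = m by rewrite addn1 (partner_adj ms1 sP sm).
have free0 : rpartner s m 0 = 1.
  by rewrite rpartner_right ?addn0 ?sm ?subSnn // leqnSn.
have free1 : rpartner s m 1 = 0.
  by rewrite rpartner_right ?pm1 ?subnn // addn1.
have := card_linked_walk sP m_lt s_gt2 DL; rewrite /= free0 free1 /= expn1 => /leq_trans; apply.
rewrite !leq_mul2r; do 2 (apply/orP; right).
pose corner (w : 3.-tuple 'I_N) := (nth x0 w 0, nth x0 w 1, nth x0 w 2).
rewrite -(card_in_imset (f := corner)) => [|w w' _ _ [eq0 eq1 eq2]]; last first.
  apply: val_inj; apply: (@eq_from_nth _ x0); rewrite !size_tuple //.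
  by case=> [|[|[|]]].
apply: subset_leq_card; apply/fintype.subsetP => z /imsetP [w /imsetP [i iD ->] ->].
have := DL i iD m m_lt; move: iD; rewrite !inE /corner !nth_window // sm => /andP [_ corner_open].
rewrite /visit addn0 addn1 addn2 /edge size_tuple !modn_small // => -> /=.
by rewrite eq_sym.
Qed.

Hypothesis r_flip : forall p q : 'I_N, r (p, q) (q, p).

Let card_max_vertex_equiv : #|[set t : 'I_N * ('I_N * 'I_N * 'I_N) |
    r (t.1, t.2.1.1) (t.2.1.2, t.2.2)]| <= max_vertex_equiv * N.
Proof.
set A := [set _ | _].
have card_fst : #|[set t.1 | t in A]| <= N by rewrite -[leqRHS]card_ord max_card.
apply: (leq_trans _ (leq_mul (leqnn _) card_fst)); apply: card_le_fibers => p _.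
rewrite -(card_in_imset (f := snd)) => [|[p1 t1] [p2 t2]]; last first.
  by rewrite !inE /= => /andP [_ /eqP ->] /andP [_ /eqP ->] ->.
apply: (leq_trans _ (leq_bigmax p)).
apply: subset_leq_card; apply/fintype.subsetP => z /imsetP [[q t]].
by rewrite !inE /= => /andP [h /eqP <-] ->.
Qed.

(* The four vertices of two equivalent edges number at most [max_vertex_equiv * N] instead
   of [N ^ 3]; the remaining ones of the window are arbitrary. *)
Lemma card_window_block s (D : {set (size s).-tuple 'I_N}) m l : 1 < l ->
  m + l < size s -> (forall i, i \in D -> linked s i) -> nth 0 s m = m + l ->
  #|window x0 m l.+1 @: D| <= max_vertex_equiv * N ^ l.-1.
Proof.
move=> l_gt1 ml DL sm; have m_lt : m < size s by lia.
pose ends_and_inside (w : l.+2.-tuple 'I_N) :=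
  ((nth x0 w 1, (nth x0 w 0, nth x0 w l, nth x0 w l.+1)),
   [tuple nth x0 w x.+2 | x < l.-2]).
rewrite -(card_in_imset (f := ends_and_inside)) => [|w w' _ _ ww']; last first.
  have [eq1 eq0 eql eql1 _] := ww'; have eq_inside := congr1 snd ww'.
  apply: val_inj; apply: (@eq_from_nth _ x0); rewrite !size_tuple //.
  case=> [//|[//|x]] xl; have [x_in|x_out] := ltnP x l.-2.
    by have := congr1 (fun t => tnth t (Ordinal x_in)) eq_inside; rewrite !tnth_mktuple.
  by have [->//|->//] : x.+2 = l \/ x.+2 = l.+1 by lia.
apply: (@leq_trans #|finset.setX [set t : 'I_N * ('I_N * 'I_N * 'I_N) |
    r (t.1, t.2.1.1) (t.2.1.2, t.2.2)] [set: l.-2.-tuple 'I_N]|); last first.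
  rewrite cardsX cardsT card_tuple card_ord.
  rewrite (leq_trans (leq_mul card_max_vertex_equiv (leqnn _))) //.
  by rewrite -mulnA -expnS (_ : l.-2.+1 = l.-1) //; lia.
apply: subset_leq_card; apply/fintype.subsetP => z /imsetP [w /imsetP [i /DL iL ->] ->].
rewrite !inE /= andbT !nth_window // /visit addn0 addn1 addnS.
apply: (equivalence_rel_trans r_equiv (r_flip _ _)).
have := iL m m_lt; rewrite sm /edge size_tuple [m %% _]modn_small //.
by rewrite [(m + l) %% _]modn_small.
Qed.

Lemma card_linked_nonadjacent s (D : {set (size s).-tuple 'I_N}) :
  pairing s -> 2 < size s -> nonadjacent s -> (forall i, i \in D -> linked s i) ->
  #|D| * N <= max_vertex_equiv * N ^ (size s)./2 * B ^ size s.
Proof.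
move=> sP s_gt2 nadj DL.
have [m [l [l_gt1 ml sm outside]]] := exists_shortest_block sP s_gt2 nadj.
have m_lt : m < size s by lia.
have free t : t < l -> t < rpartner s m t.
  move=> tl; have mt : m + t < size s by lia.
  have [t0|t_gt0] := posnP t.
    by rewrite rpartner_right // t0 addn0 sm //; lia.
  have [left|right] := outside t t_gt0 tl; first by rewrite rpartner_left //; lia.
  by rewrite rpartner_right //; lia.
have l1_lt : l.+1 < size s.
  have m1_lt : m + 1 < size s by lia.
  by have [p_lt _ _] := sP _ m1_lt; have := outside 1 isT l_gt1; lia.
have card_D := card_linked_walk sP m_lt l1_lt DL.
set nfree := count _ _ in card_D.
have l_le : l <= nfree.
  rewrite /nfree -[in iota 0 _](addn1 l) iotaD count_cat -[leqLHS](size_iota 0).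
  have <- : count (fun t => t < rpartner s m t) (iota 0 l) = size (iota 0 l).
    by apply/eqP; rewrite -all_count; apply/allP => t; rewrite mem_iota => /free.
  exact: leq_addr.
have {}card_D : #|D| * N ^ l <=
    max_vertex_equiv * N ^ l.-1 * N ^ (size s)./2 * B ^ size s.
  apply: (leq_trans (leq_mul (leqnn _) (leq_pexp2l N_gt0 l_le))); apply: (leq_trans card_D).
  by rewrite !leq_mul // card_window_block.
have Nl_gt0 : 0 < N ^ l.-1 by rewrite expn_gt0 N_gt0.
rewrite -(leq_pmul2r Nl_gt0); move: card_D; rewrite -{1}(prednK (ltnW l_gt1)) expnS mulnA.
by move=> /leq_trans; apply; apply: eq_leq; ring.
Qed.

Definition exceptional k s : {set k.-tuple 'I_N} :=
  [set i : k.-tuple 'I_N | `[< linked s i /\ ~ (noncrossing s /\ folds x0 s i) >]].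

Lemma exceptional_size2 s : pairing s -> size s = 2 ->
  exceptional (size s) s = finset.set0.
Proof.
move=> sP s2; rewrite (pairing2 sP s2); apply/finset.setP => i; rewrite !inE.
apply/asboolP => -[_]; apply; split=> [[|[|//]] [|[|//]] //|[|[|//]] _];
  by rewrite /edge /= !size_tuple.
Qed.

Lemma card_exceptional_del s m : pairing s -> m.+2 < size s -> nth 0 s m = m.+1 ->
  #|[set i in exceptional (size s) s | nth x0 i m == nth x0 i m.+2]|
    <= N * #|exceptional (size (del_block m s)) (del_block m s)|.
Proof.
move=> sP ms sm; set s' := del_block m s; set E := [set i in _ | _].
have ms1 := ltnW ms; have s'P := pairing_del ms1 sP sm.
have ss' : size s' = size s - 2 by rewrite size_del_block.
have mi (i : (size s).-tuple 'I_N) : m.+2 < size i by rewrite size_tuple.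
pose del (i : (size s).-tuple 'I_N) : (size s').-tuple 'I_N :=
  [tuple nth x0 (del_vertex m i) j | j < size s'].
have delE i : del i = del_vertex m i :> seq _.
  apply: (@eq_from_nth _ x0); first by rewrite size_tuple size_del_vertex ?size_tuple.
  by move=> j; rewrite size_tuple => js; rewrite (nth_mktuple _ _ (Ordinal js)).
apply: (@leq_trans (N * #|del @: E|)); last first.
  rewrite leq_mul2l subset_leq_card ?orbT //; apply/fintype.subsetP => _ /imsetP [i + ->].
  rewrite !inE => /andP [/asboolP [iL i_bad] /eqP im].
  have edge_i j : j < size s' -> edge x0 (del i) j = edge x0 i (skip m j).
    by move=> js; rewrite delE edge_del // size_tuple -ss'.
  split.
    move=> j js; have [p_lt _ _] := s'P j js; rewrite !edge_i //.
    by rewrite skip_del_block -?ss' //; apply: iL; rewrite skip_lt -?ss'.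
  move=> [s'nc del_folds]; apply: i_bad; split; first exact/(noncrossing_del ms1 sP sm).
  by apply/(folds_del x0 sP ms sm (size_tuple i)); rewrite -delE.
apply: card_le_fibers => y _.
rewrite -(card_in_imset (f := fun i : (size s).-tuple 'I_N => nth x0 i m.+1)).
  by rewrite -[leqRHS]card_ord max_card.
move=> i i'; rewrite !inE => /andP [/andP [_ /eqP im] /eqP <-].
move=> /andP [/andP [_ /eqP im'] /eqP del_eq] eq_m1.
have eq_skip j : nth x0 i (skip m.+1 j) = nth x0 i' (skip m.+1 j).
  by rewrite -!nth_del_vertex // -!delE del_eq.
apply: val_inj; apply: (@eq_from_nth _ x0); rewrite !size_tuple // => j js.
have [->//|j_neq1] := eqVneq j m.+1.
have [->|j_neq2] := eqVneq j m.+2; last by rewrite -(unskipK j_neq1 j_neq2).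
by rewrite -im -im'; have := eq_skip m; rewrite /skip ltnSn.
Qed.

Lemma exceptional_linked k s (i : k.-tuple 'I_N) : i \in exceptional k s -> linked s i.
Proof. by rewrite inE => /asboolP []. Qed.

Lemma card_exceptional_adj s m : pairing s -> m.+2 < size s -> nth 0 s m = m.+1 ->
  #|exceptional (size s) s| * N <= open_corners * N ^ (size s)./2 * B ^ size s +
    N * (#|exceptional (size (del_block m s)) (del_block m s)| * N).
Proof.
move=> sP ms sm; set E := exceptional (size s) s.
set closed_corner := [set i : (size s).-tuple 'I_N | nth x0 i m == nth x0 i m.+2].
rewrite -(cardsID closed_corner E) -finset.setIdE addnC mulnDl; apply: leq_add.
  apply: leq_trans (card_linked_open_corner sP ms sm).
  rewrite leq_mul2r subset_leq_card ?orbT //; apply/fintype.subsetP => i.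
  rewrite finset.in_setD => /andP [i_open /exceptional_linked/asboolP iL].
  by rewrite finset.in_set iL; rewrite finset.in_set in i_open.
by rewrite mulnA leq_mul2r card_exceptional_del ?orbT.
Qed.

Lemma card_exceptional k s : size s = k -> pairing s -> 1 < k ->
  #|exceptional k s| * N <= k * B ^ k * (max_vertex_equiv + open_corners) * N ^ k./2.
Proof.
elim/ltn_ind: k s => k IH s sk; subst k => sP s_gt1.
have s_even := pairing_even sP.
have [s2|s_gt2] : size s = 2 \/ 2 < size s by lia.
  by rewrite exceptional_size2 ?cards0.
have [[m ms sm]|nadj] := pselect (exists2 m, m.+2 < size s & nth 0 s m = m.+1); last first.
  have no_adj : nonadjacent s by move=> m ms sm; apply: nadj; exists m.
  apply: (leq_trans (card_linked_nonadjacent sP s_gt2 no_adj (@exceptional_linked _ s))).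
  rewrite mulnAC leq_mul2r mulnC; apply/orP; right.
  by rewrite leq_mul ?leq_addr // leq_pmull // ltnW.
apply: (leq_trans (card_exceptional_adj sP ms sm)).
set s' := del_block m s; have ms1 := ltnW ms.
have s'P : pairing s' := pairing_del ms1 sP sm.
have ss' : size s' = size s - 2 := size_del_block ms1.
have s'_lt : size s' < size s by lia.
have s'_gt1 : 1 < size s' by lia.
have /(leq_mul (leqnn N)) card_s' := IH _ s'_lt s' erefl s'P s'_gt1.
pose C := B ^ size s * (max_vertex_equiv + open_corners) * N ^ (size s)./2.
have -> : size s * B ^ size s * (max_vertex_equiv + open_corners) * N ^ (size s)./2 =
    2 * C + size s' * C.
  by rewrite -mulnDl ss' subnKC ?(ltnW s_gt2) // /C !mulnA.
apply: leq_add.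
  rewrite /C mulnAC [leqRHS]mulnA leq_mul // mulnC (leq_trans _ (leq_pmull _ _)) //.
  by rewrite leq_mul2l leq_addl orbT.
apply: (leq_trans card_s'); rewrite /C; have -> : (size s)./2 = (size s')./2.+1 by lia.
rewrite expnS [leqRHS]mulnA [leqRHS]mulnCA leq_mul // -!mulnA !leq_mul //.
by rewrite leq_pexp2l // ltnW.
Qed.

End CountLinked.

Local Open Scope classical_set_scope.
Local Open Scope ring_scope.

(** * Iterated integrals as limits of Riemann sums *)

Lemma big_tuple_cons (R : Type) (idx : R) (op : Monoid.com_law idx) (T : finType) n
    (F : n.+1.-tuple T -> R) :
  \big[op/idx]_(t : n.+1.-tuple T) F t =
  \big[op/idx]_(x : T) \big[op/idx]_(t : n.-tuple T) F [tuple of x :: t].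
Proof.
rewrite pair_big /= (reindex (fun q : T * n.-tuple T => [tuple of q.1 :: q.2])) //=.
exists (fun t : n.+1.-tuple T => (thead t, behead_tuple t)) => [[x t] _|t _] /=.
  by congr pair; apply: val_inj.
by rewrite [RHS]tuple_eta; apply: val_inj.
Qed.

Lemma big_tuple0 (R : Type) (idx : R) (op : Monoid.com_law idx) (T : finType)
    (F : 0.-tuple T -> R) : \big[op/idx]_(t : 0.-tuple T) F t = F [tuple].
Proof. by rewrite (big_pred1 [tuple]) // => t; apply/esym/eqP/tuple0. Qed.

(* No measurability is assumed: the integral of a nonnegative function is a supremum
   over the simple functions below it. *)
Lemma ge0_le_integral_nomeas d (T : measurableType d) (R : realType)
    (mu : {measure set T -> \bar R}) (D : set T) (f g : T -> \bar R) :
  (forall x, D x -> 0 <= f x)%E -> (forall x, D x -> f x <= g x)%E ->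
  (\int[mu]_(x in D) f x <= \int[mu]_(x in D) g x)%E.
Proof.
move=> f0 fg; have g0 x : D x -> (0 <= g x)%E by move=> Dx; exact: le_trans (f0 x Dx) (fg x Dx).
rewrite !ge0_integralE //; apply: ereal_sup_le => _ [h /= hf <-]; exists h => //= x.
by apply: le_trans (hf x) _; apply: lee_restrict.
Qed.

Section Cells.
Variable R : realType.
Local Notation mu := (@lebesgue_measure R).
Implicit Types (N n i : nat) (x : R).

Definition cell N i : set R := `[i%:R / N%:R, i.+1%:R / N%:R].

Definition cell_co N i : set R := `[i%:R / N%:R, i.+1%:R / N%:R[.

Lemma cellE N i x : cell N i x = (i%:R / N%:R <= x <= i%:R / N%:R + N%:R^-1).
Proof. by rewrite /cell /= in_itv /= -natr1 mulrDl mul1r. Qed.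

Lemma cell_coW N i : cell_co N i `<=` cell N i.
Proof. by move=> x; rewrite /cell /cell_co /= !in_itv /= => /andP [-> /ltW]. Qed.

Lemma cell_left N i : cell N i (i%:R / N%:R).
Proof. by rewrite cellE lexx lerDl invr_ge0 ler0n. Qed.

Lemma cell_right N i : cell N i (i.+1%:R / N%:R).
Proof. by rewrite cellE -natr1 mulrDl mul1r lexx lerDl invr_ge0 ler0n. Qed.

Lemma cell_sub01 N i : (i < N)%N -> cell N i `<=` `[0, 1].
Proof.
move=> iN x; rewrite /cell /= !in_itv /= => /andP [x_ge x_le].
have N_gt0 : (0 < N)%N by exact: leq_ltn_trans iN.
rewrite (le_trans _ x_ge) ?divr_ge0 //= (le_trans x_le) //.
by rewrite ler_pdivrMr ?ltr0n // mul1r ler_nat.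
Qed.

Lemma cell_co_cover N x : (0 < N)%N -> 0 <= x < 1 -> exists2 i, (i < N)%N & cell_co N i x.
Proof.
rewrite -(ltr0n R) => N_gt0 /andP [x_ge0 x_lt1].
have /andP [trunc_le lt_trunc] := truncn_itv (mulr_ge0 x_ge0 (ler0n R N)).
exists (Num.truncn (x * N%:R)).
  by rewrite -(ltr_nat R) (le_lt_trans trunc_le) // -[ltRHS]mul1r ltr_pM2r.
by rewrite /cell_co /= in_itv /= ler_pdivrMr // trunc_le ltr_pdivlMr.
Qed.

Lemma cell_cover N x : (0 < N)%N -> 0 <= x <= 1 -> exists2 i, (i < N)%N & cell N i x.
Proof.
move=> N_gt0 /andP [x_ge0]; rewrite le_eqVlt => /predU1P [->|x_lt1].
  exists N.-1; first by rewrite prednK.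
  by have := cell_right N N.-1; rewrite prednK // divff // pnatr_eq0 -lt0n.
have [|i iN ix] := cell_co_cover N_gt0 (x := x); first by rewrite x_ge0.
by exists i => //; apply: cell_coW.
Qed.

Lemma cell_co_inj N i j x : (0 < N)%N -> cell_co N i x -> cell_co N j x -> i = j.
Proof.
rewrite -(ltr0n R) => N_gt0; rewrite /cell_co /= !in_itv /= => /andP [ix xi] /andP [jx xj].
have := le_lt_trans ix xj; have := le_lt_trans jx xi.
rewrite !ltr_pM2r ?invr_gt0 // !ltr_nat; lia.
Qed.

Lemma lebesgue_measure_cell N i : (0 < N)%N ->
  mu (cell N i) = N%:R^-1%:E /\ mu (cell_co N i) = N%:R^-1%:E.
Proof.
rewrite -(ltr0n R) => N_gt0; rewrite /cell /cell_co !lebesgue_measure_itv /= lte_fin.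
rewrite ltr_pM2r ?invr_gt0 // ltr_nat leqnn -EFinB -natr1.
by rewrite mulrDl mul1r addrAC subrr add0r.
Qed.

Lemma integral_sum_indic N (A : nat -> set R) (c : nat -> R) :
  (forall i, measurable (A i)) -> (forall i, 0 <= c i) ->
  (\int[mu]_(x in `[0%R, 1%R]%classic) (\sum_(i < N) (c i * \1_(A i) x)%:E) =
   \sum_(i < N) (c i)%:E * mu (A i `&` `[0%R, 1%R]%classic))%E.
Proof.
move=> mA c_ge0; rewrite ge0_integral_sum // => [|i|i x _]; last 2 first.
- by apply/measurable_EFinP/measurable_funM => //; exact: measurable_indic (mA i).
- by rewrite lee_fin mulr_ge0.
apply: eq_bigr => i _; under eq_integral do rewrite EFinM.
rewrite ge0_integralZl ?lee_fin //.
- by rewrite integral_indic //; exact: mA.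
- by apply/measurable_EFinP; exact: measurable_indic (mA i).
Qed.

Lemma integral_le_cell_avg N (h : R -> \bar R) (c : nat -> R) : (0 < N)%N ->
  (forall x, 0 <= h x)%E -> (forall i, 0 <= c i) ->
  (forall i x, (i < N)%N -> cell N i x -> (h x <= (c i)%:E)%E) ->
  (\int[mu]_(x in `[0%R, 1%R]%classic) h x <= (N%:R^-1 * \sum_(i < N) c i)%:E)%E.
Proof.
move=> N_gt0 h_ge0 c_ge0 hc.
have mcell i : measurable (cell N i) by exact: measurable_itv.
apply: (@le_trans _ _ (\int[mu]_(x in `[0%R, 1%R]%classic)
    (\sum_(i < N) (c i * \1_(cell N i) x)%:E))%E).
  apply: ge0_le_integral_nomeas => // x; rewrite /= in_itv /= => x01.
  have [i iN xi] := cell_cover N_gt0 x01.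
  rewrite (bigD1 (Ordinal iN)) //= (le_trans (hc i x iN xi)) //.
  rewrite indicE mem_set // mulr1 leeDl // sume_ge0 // => j _.
  by rewrite lee_fin mulr_ge0.
rewrite integral_sum_indic // mulr_sumr -sumEFin; apply: lee_sum => i _.
rewrite mulrC EFinM lee_pmul ?lee_fin // -(lebesgue_measure_cell i N_gt0).1.
apply: le_measure; rewrite ?inE; [|exact: mcell|exact: subIsetl].
by apply: measurableI => //; exact: measurable_itv.
Qed.

Lemma cell_avg_le_integral N (h : R -> \bar R) (c : nat -> R) : (0 < N)%N ->
  (forall x, 0 <= h x)%E -> (forall i, 0 <= c i) ->
  (forall i x, (i < N)%N -> cell N i x -> ((c i)%:E <= h x)%E) ->
  ((N%:R^-1 * \sum_(i < N) c i)%:E <= \int[mu]_(x in `[0%R, 1%R]%classic) h x)%E.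
Proof.
move=> N_gt0 h_ge0 c_ge0 ch.
have mcell i : measurable (cell_co N i) by exact: measurable_itv.
apply: (@le_trans _ _ (\int[mu]_(x in `[0%R, 1%R]%classic)
    (\sum_(i < N) (c i * \1_(cell_co N i) x)%:E))%E).
  rewrite integral_sum_indic // mulr_sumr -sumEFin; apply: lee_sum => i _.
  rewrite mulrC EFinM (setIidl (_ : cell_co N i `<=` _)) ?(lebesgue_measure_cell i N_gt0).2 //.
  by apply: subset_trans (cell_sub01 (ltn_ord i)); exact: cell_coW.
apply: ge0_le_integral_nomeas => x _.
  by rewrite sume_ge0 // => i _; rewrite lee_fin mulr_ge0.
have [[i xi]|x_out] := pselect (exists i : 'I_N, cell_co N i x); last first.
  rewrite big1 ?h_ge0 // => i _; rewrite indicE memNset ?mulr0 // => xi.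
  by apply: x_out; exists i.
rewrite (bigD1 i) //= big1 ?adde0 => [|j ji].
  by rewrite indicE mem_set // mulr1; apply: ch => //; exact: cell_coW.
rewrite indicE memNset ?mulr0 // => xj; move/eqP: ji; apply.
by apply: val_inj; exact: cell_co_inj xj xi.
Qed.

End Cells.

Section CubeAverages.
Variable R : realType.
Implicit Types (N n : nat) (g h : seq nat -> R).

Definition cube_avg N n g : R := (N%:R ^+ n)^-1 * \sum_(a : n.-tuple 'I_N) g (map val a).

Lemma cube_avgS N n g :
  cube_avg N n.+1 g = N%:R^-1 * \sum_(i < N) cube_avg N n (fun a => g (val i :: a)).
Proof. by rewrite /cube_avg big_tuple_cons exprS invfM -mulrA -mulr_sumr. Qed.

Lemma cube_avg0 N g : cube_avg N 0 g = g [::].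
Proof. by rewrite /cube_avg big_tuple0 expr0 invr1 mul1r. Qed.

Lemma cube_avg_ge0 N n g : (forall a, 0 <= g a) -> 0 <= cube_avg N n g.
Proof. by move=> g_ge0; rewrite mulr_ge0 ?invr_ge0 ?exprn_ge0 // sumr_ge0. Qed.

Lemma le_cube_avg N n g h :
  (forall a, size a = n -> all (fun i => i < N)%N a -> g a <= h a) ->
  cube_avg N n g <= cube_avg N n h.
Proof.
move=> gh; rewrite ler_wpM2l ?invr_ge0 ?exprn_ge0 // ler_sum // => a _; apply: gh.
  by rewrite size_map size_tuple.
by apply/allP => _ /mapP [i _ ->] /=.
Qed.

Lemma cube_avgB N n g h :
  cube_avg N n (fun a => g a - h a) = cube_avg N n g - cube_avg N n h.
Proof. by rewrite /cube_avg sumrB mulrBr. Qed.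

Lemma cube_avgZ N n (c : R) g : cube_avg N n (fun a => c * g a) = c * cube_avg N n g.
Proof. by rewrite /cube_avg -mulr_sumr mulrCA. Qed.

Lemma cube_avg_sum (I : Type) N n (s : seq I) (g : I -> seq nat -> R) :
  cube_avg N n (fun a => \sum_(e <- s) g e a) = \sum_(e <- s) cube_avg N n (g e).
Proof. by rewrite /cube_avg exchange_big mulr_sumr. Qed.

Lemma avg_cst N (c : R) : (0 < N)%N -> N%:R^-1 * \sum_(i < N) c = c.
Proof.
by move=> N_gt0; rewrite sumr_const card_ord -[c *+ N]mulr_natl mulKf // pnatr_eq0 -lt0n.
Qed.

Lemma avg_le N (F : 'I_N -> R) c : (0 < N)%N -> (forall i, F i <= c) ->
  N%:R^-1 * \sum_(i < N) F i <= c.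
Proof.
by move=> N_gt0 Fc; rewrite -[leRHS](avg_cst c N_gt0) ler_wpM2l ?invr_ge0 // ler_sum.
Qed.

Lemma cube_avg_cst N n (c : R) : (0 < N)%N -> cube_avg N n (fun=> c) = c.
Proof.
move=> N_gt0; rewrite /cube_avg sumr_const card_tuple card_ord -[c *+ _]mulr_natl natrX.
by rewrite mulKf // expf_neq0 // pnatr_eq0 -lt0n.
Qed.

Lemma cube_avg_coord N n v (w : nat -> R) : (0 < N)%N -> (v < n)%N ->
  cube_avg N n (fun a => w (nth 0%N a v)) = N%:R^-1 * \sum_(i < N) w i.
Proof.
move=> N_gt0; elim: n v => [//|n IH] [|v] vn; rewrite cube_avgS /=.
  by congr (_ * _); apply: eq_bigr => i _; rewrite cube_avg_cst.
under eq_bigr do rewrite IH //.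
exact: avg_cst.
Qed.

Lemma sum_dist_le N i (w : nat -> R) : (i < N)%N -> (forall m, 0 <= w m) ->
  \sum_(j < N) w `|i - j|%N <= 2 * \sum_(m < N) w m.
Proof.
move=> iN w_ge0; rewrite mulr_natl mulr2n -(big_mkord xpredT (fun j => w `|i - j|%N)).
rewrite -(big_mkord xpredT w).
have le_sum n1 n2 : (n1 <= n2)%N -> \sum_(0 <= m < n1) w m <= \sum_(0 <= m < n2) w m.
  by move=> n12; rewrite [leRHS](big_cat_nat (leq0n n1) n12) //= lerDl sumr_ge0.
rewrite (big_cat_nat (leq0n i.+1) iN) //=; apply: lerD.
  rewrite big_nat_rev /= add0n.
  rewrite (eq_big_nat _ _ (F2 := w)) => [|j /andP [_ ji]]; first exact: le_sum.
  by congr w; lia.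
rewrite -{1}[i.+1]add0n big_addn.
rewrite (eq_big_nat _ _ (F2 := fun j => w j.+1)) => [|j _]; last by congr w; lia.
have iN' : (N - i.+1 < N)%N by lia.
by apply: le_trans (le_sum _ _ iN'); rewrite big_nat_recl //= lerDr.
Qed.

Lemma cube_avg_dist_le N n u v (w : nat -> R) : (0 < N)%N ->
  (u < n)%N -> (v < n)%N -> u != v -> (forall m, 0 <= w m) ->
  cube_avg N n (fun a => w `|nth 0%N a u - nth 0%N a v|%N) <=
  2 * (N%:R^-1 * \sum_(m < N) w m).
Proof.
move=> N_gt0 + + + w_ge0.
have avg_dist_le (i : 'I_N) :
    N%:R^-1 * \sum_(j < N) w `|i - j|%N <= 2 * (N%:R^-1 * \sum_(m < N) w m).
  by rewrite mulrCA ler_wpM2l ?invr_ge0 // sum_dist_le.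
elim: n u v => [//|n IH] [|u] [|v] //= un vn uv; rewrite cube_avgS; apply: avg_le => // i /=.
- by rewrite (cube_avg_coord (fun j => w `|i - j|%N)).
- rewrite (cube_avg_coord (fun j => w `|j - i|%N)) //.
  have -> // : \sum_(j < N) w `|j - i|%N = \sum_(j < N) w `|i - j|%N.
  by apply: eq_bigr => j _; rewrite distnC.
- exact: IH.
Qed.

Definition in_cells N (a : seq nat) (x : seq R) := size a = size x /\
  forall j, (j < size a)%N -> (nth 0%N a j < N)%N /\ cell N (nth 0%N a j) (nth 0 x j).

Lemma in_cells_cons N i t a x : (i < N)%N -> cell N i t -> in_cells N a x ->
  in_cells N (i :: a) (t :: x).
Proof. by move=> iN it [sax ax]; split=> [|[|j]] //=; [rewrite sax | exact: ax]. Qed.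

Lemma in_cells_grid N a : (0 < N)%N -> all (fun i => (i < N)%N) a ->
  in_cells N a [seq i%:R / N%:R | i <- a].
Proof.
move=> N_gt0 /all_nthP aN; split=> [|j js]; first by rewrite size_map.
by split; [exact: aN | rewrite (nth_map 0%N) //; exact: cell_left].
Qed.

Lemma cube_int_ge0 n (f : seq R -> \bar R) :
  (forall x, 0 <= f x)%E -> (0 <= cube_int n f)%E.
Proof.
by elim: n f => [|n IH] f f_ge0 //=; apply: integral_ge0 => t _; apply: IH.
Qed.

Lemma cube_int_le_avg N n (f : seq R -> \bar R) g : (0 < N)%N ->
  (forall x, 0 <= f x)%E -> (forall a, 0 <= g a) ->
  (forall a x, size a = n -> in_cells N a x -> (f x <= (g a)%:E)%E) ->
  (cube_int n f <= (cube_avg N n g)%:E)%E.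
Proof.
move=> N_gt0; elim: n f g => [|n IH] f g f_ge0 g_ge0 fg /=; first by rewrite cube_avg0 fg.
rewrite cube_avgS.
apply: (integral_le_cell_avg (c := fun i => cube_avg N n (fun a => g (i :: a)))) => //.
- by move=> t; apply: cube_int_ge0.
- by move=> i; apply: cube_avg_ge0.
- move=> i t iN it; apply: IH => // a x sa ax.
  by apply: fg; [rewrite /= sa | exact: in_cells_cons].
Qed.

Lemma avg_le_cube_int N n (f : seq R -> \bar R) g : (0 < N)%N ->
  (forall x, 0 <= f x)%E -> (forall a, 0 <= g a) ->
  (forall a x, size a = n -> in_cells N a x -> ((g a)%:E <= f x)%E) ->
  ((cube_avg N n g)%:E <= cube_int n f)%E.
Proof.
move=> N_gt0; elim: n f g => [|n IH] f g f_ge0 g_ge0 fg /=; first by rewrite cube_avg0 fg.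
rewrite cube_avgS.
apply: (cell_avg_le_integral (c := fun i => cube_avg N n (fun a => g (i :: a)))) => //.
- by move=> t; apply: cube_int_ge0.
- by move=> i; apply: cube_avg_ge0.
- move=> i t iN it; apply: IH => // a x sa ax.
  by apply: fg; [rewrite /= sa | exact: in_cells_cons].
Qed.

End CubeAverages.

Section Oscillation.
Variable R : realType.
Implicit Types f : R -> R.

Definition vanishing_oscillation f := forall e : R, 0 < e -> \forall n \near \oo,
  forall xi eta : nat -> R,
  (forall i, (i < n)%N -> cell n i (xi i) /\ cell n i (eta i)) ->
  n%:R^-1 * \sum_(i < n) `|f (xi i) - f (eta i)| < e.

Lemma vanishing_oscillation_riemann f : riemann_integrable01 f -> vanishing_oscillation f.
Proof.
move=> [I f_int] e e_gt0; have e2_gt0 : 0 < e / 2 by rewrite divr_gt0.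
have [delta delta_gt0 {}f_int] := f_int _ e2_gt0.
near=> n => xi eta xi_eta.
have n_gt0 : 0 < n%:R :> R by near: n; exact: nbhs_infty_gtr.
have mesh_lt : n%:R^-1 < delta.
  by rewrite -[delta]invrK ltf_pV2 ?posrE ?invr_gt0 //; near: n; exact: nbhs_infty_gtr.
pose t (i : nat) : R := i%:R / n%:R.
have mesh i : t i.+1 - t i = n%:R^-1 by rewrite /t -mulrBl -natr1 addrAC subrr add0r mul1r.
have riemann_sum tag : (forall i, (i < n)%N -> cell n i (tag i)) ->
    `| \sum_(i < n) f (tag i) * n%:R^-1 - I | < e / 2.
  move=> tagP; have := f_int n t tag; rewrite /t mul0r divff ?gt_eqF // => /(_ erefl erefl).
  under eq_bigr do rewrite mesh; apply=> i iN; split.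
  - by rewrite -subr_ge0 mesh invr_ge0 ltW.
  - by rewrite mesh.
  - by have := tagP i iN; rewrite /cell /= in_itv.
pose hi i := if f (eta i) <= f (xi i) then xi i else eta i.
pose lo i := if f (eta i) <= f (xi i) then eta i else xi i.
have hi_cell i : (i < n)%N -> cell n i (hi i).
  by move=> /xi_eta [? ?]; rewrite /hi; case: ifP.
have lo_cell i : (i < n)%N -> cell n i (lo i).
  by move=> /xi_eta [? ?]; rewrite /lo; case: ifP.
have -> : n%:R^-1 * \sum_(i < n) `|f (xi i) - f (eta i)| =
    (\sum_(i < n) f (hi i) * n%:R^-1 - I) - (\sum_(i < n) f (lo i) * n%:R^-1 - I).
  rewrite opprB addrA subrK -sumrB mulr_sumr; apply: eq_bigr => i _.
  rewrite -mulrBl mulrC; congr (_ * _); rewrite /hi /lo.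
  case: leP => [le_f|lt_f]; first by rewrite ger0_norm // subr_ge0.
  by rewrite ltr0_norm ?opprB // subr_lt0.
have := riemann_sum _ hi_cell; have := riemann_sum _ lo_cell; rewrite !ltr_norml; lra.
Unshelve. all: by end_near. Qed.

Lemma vanishing_oscillation_sqr f (C : R) : (forall x : R, 0 <= x <= 1 -> `|f x| <= C) ->
  vanishing_oscillation f -> vanishing_oscillation (fun x => f x ^+ 2).
Proof.
move=> fC f_osc e e_gt0.
have C_ge0 : 0 <= C by apply: le_trans (fC 0 _) => //; rewrite lexx ler01.
have C1_gt0 : 0 < 2 * (C + 1) by lra.
apply: filterS (f_osc _ (divr_gt0 e_gt0 C1_gt0)) => n {}f_osc xi eta xi_eta.
have := f_osc xi eta xi_eta; rewrite ltr_pdivlMr // mulrC; apply: le_lt_trans.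
rewrite mulrCA ler_wpM2l ?invr_ge0 // mulr_sumr; apply: ler_sum => i _.
have [/(cell_sub01 (ltn_ord i)) + /(cell_sub01 (ltn_ord i))] := xi_eta i (ltn_ord i).
rewrite /= !in_itv /= => /fC xiC /fC etaC.
rewrite subr_sqr normrM mulrC ler_wpM2r // (le_trans (ler_normD _ _)) //; lra.
Qed.

(* Where [`|x - y|] lies when [x] and [y] are in cells at distance [m]. *)
Definition nearby n m : set R := [set x | 0 <= x <= 1 /\ `|x - m%:R / n%:R| <= n%:R^-1].

Lemma nearby_grid n m : (0 < n)%N -> (m <= n)%N -> nearby n m (m%:R / n%:R).
Proof.
move=> n_gt0 mn; rewrite /nearby /= subrr normr0 invr_ge0 ler0n divr_ge0 //.
by rewrite ler_pdivrMr ?ltr0n // mul1r ler_nat mn.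
Qed.

Lemma natr_dist (a b : nat) : `|a - b|%:R = `|a%:R - b%:R| :> R.
Proof. by rewrite natr_absz intr_norm rmorphB. Qed.

Lemma nearby_cells N a b (x y : R) : (a < N)%N -> (b < N)%N ->
  cell N a x -> cell N b y -> nearby N `|a - b|%N `|x - y|.
Proof.
move=> aN bN ax bx; have /= := cell_sub01 aN ax; have /= := cell_sub01 bN bx.
rewrite !in_itv /= => /andP [y_ge0 y_le1] /andP [x_ge0 x_le1].
split; first by rewrite normr_ge0 ler_norml; lra.
rewrite natr_dist -[N%:R^-1 in X in `|_ - X|](@ger0_norm _ N%:R^-1) ?invr_ge0 //.
rewrite -normrM mulrBl (le_trans (ler_dist_dist _ _)) //.
by move: ax bx; rewrite !cellE ler_norml; lra.
Qed.

Lemma ler_sum_shift n (G H : nat -> R) : G 0%N = 0 -> (forall i, 0 <= H i) ->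
  (forall i, (i.+1 < n)%N -> G i.+1 <= H i) -> \sum_(m < n) G m <= \sum_(i < n) H i.
Proof.
case: n => [|n] G0 H_ge0 GH; first by rewrite !big_ord0.
rewrite big_ord_recl [leRHS]big_ord_recr /= G0 add0r ler_wpDr // ler_sum // => i _.
exact: (GH i (ltn_ord i)).
Qed.

(* A point near [m / n] is in one of the two cells meeting there; the right parts and the
   left parts of the points then serve as tags of the same partition. *)
Lemma nearby_oscillation f (e : R) : vanishing_oscillation f -> 0 < e -> \forall n \near \oo,
  forall z : nat -> R, (forall m, (m < n)%N -> nearby n m (z m)) ->
  n%:R^-1 * \sum_(m < n) `|f (z m) - f (m%:R / n%:R)| < e.
Proof.
move=> f_osc e_gt0; have e2_gt0 : 0 < e / 2 by rewrite divr_gt0.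
apply: filterS2 (f_osc _ e2_gt0) (nbhs_infty_gt 0) => n osc n_gt0 z z_near.
have mesh_gt0 : 0 < n%:R^-1 :> R by rewrite invr_gt0 ltr0n.
pose q (m : nat) : R := m%:R / n%:R.
have qS m : q m.+1 = q m + n%:R^-1 by rewrite /q -natr1 mulrDl mul1r.
pose right m := Num.max (z m) (q m).
pose left m := Num.min (z m) (q m).
have z_split m : `|f (z m) - f (q m)| = `|f (right m) - f (q m)| + `|f (left m) - f (q m)|.
  by rewrite /right /left; case: leP => _; rewrite subrr normr0 ?addr0 ?add0r.
have right_cell m : (m < n)%N -> cell n m (right m).
  move=> /z_near [_]; rewrite cellE -/(q m) ler_norml => zq.
  by rewrite /right le_max lexx orbT ge_max; lra.
have left_cell m : (m.+1 < n)%N -> cell n m (left m.+1).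
  move=> /z_near [_]; rewrite cellE -/(q m) -/(q m.+1) qS ler_norml => zq.
  by rewrite /left qS le_min ge_min lexx orbT andbT; lra.
under eq_bigr do rewrite -/(q _) z_split.
rewrite big_split mulrDr [e]splitr; apply: ltrD.
  by apply: osc => m mn; split; [exact: right_cell | exact: cell_left].
pose xi i := if (i.+1 < n)%N then left i.+1 else q i.+1.
apply: le_lt_trans (osc xi (fun i => q i.+1) _) => [|i iN]; last first.
  by split; [rewrite /xi; case: ifP => [/left_cell|_] //|]; exact: cell_right.
rewrite ler_wpM2l ?invr_ge0 //.
apply: (ler_sum_shift (G := fun m => `|f (left m) - f (q m)|)
  (H := fun i => `|f (xi i) - f (q i.+1)|)) => // [|i iN]; last by rewrite /xi iN.
have [/andP [z0_ge0 _] _] := z_near 0%N n_gt0.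
by rewrite /left /q mul0r min_r // subrr normr0.
Qed.

Section LocalBounds.
Variables (f : R -> R) (K : R).
Hypothesis f_ge0 : forall x, 0 <= f x.
Hypothesis f_le : forall x : R, 0 <= x <= 1 -> f x <= K.

(* [minn] keeps the set nonempty, so that [sup] and [inf] have no junk value. *)
Definition local_values n m : set R := [set f x | x in nearby n (minn m n)].

Definition local_sup n m := sup (local_values n m).
Definition local_inf n m := inf (local_values n m).

Let local_values_neq0 n m : (0 < n)%N -> local_values n m !=set0.
Proof.
move=> n_gt0; exists (f ((minn m n)%:R / n%:R)), ((minn m n)%:R / n%:R) => //.
by apply: nearby_grid; rewrite ?geq_minr.
Qed.

Let has_sup_local n m : (0 < n)%N -> has_sup (local_values n m).
Proof.
move=> n_gt0; split; first exact: local_values_neq0.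
by exists K => _ [x [x01 _] <-]; exact: f_le.
Qed.

Let has_inf_local n m : (0 < n)%N -> has_inf (local_values n m).
Proof. by move=> n_gt0; split; [exact: local_values_neq0 | exists 0 => _ [x _ <-]]. Qed.

Lemma local_bounds n m x : (0 < n)%N -> (m <= n)%N -> nearby n m x ->
  local_inf n m <= f x <= local_sup n m.
Proof.
move=> n_gt0 mn xm; have fx : local_values n m (f x).
  by exists x => //; rewrite (minn_idPl mn).
by rewrite ge_inf ?ub_le_sup //; [case: (has_sup_local m n_gt0) | case: (has_inf_local m n_gt0)].
Qed.

Lemma local_inf_ge0 n m : (0 < n)%N -> 0 <= local_inf n m.
Proof. by move=> n_gt0; apply: lb_le_inf => [|_ [x _ <-]] //; exact: local_values_neq0. Qed.

Lemma local_inf_le_sup n m : (0 < n)%N -> local_inf n m <= local_sup n m.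
Proof.
move=> n_gt0; have [y fy] := local_values_neq0 m n_gt0.
apply: (@le_trans _ _ y); [apply: ge_inf | apply: ub_le_sup] => //.
  by case: (has_inf_local m n_gt0).
by case: (has_sup_local m n_gt0).
Qed.

Lemma local_sup_le n m : (0 < n)%N -> local_sup n m <= K.
Proof.
move=> n_gt0; apply: ge_sup; first exact: local_values_neq0.
by move=> _ [x [x01 _] <-]; exact: f_le.
Qed.

Lemma avg_local_oscillation (e : R) : vanishing_oscillation f -> 0 < e -> \forall n \near \oo,
  n%:R^-1 * \sum_(m < n) (local_sup n m - local_inf n m) < e.
Proof.
move=> f_osc e_gt0; have e4_gt0 : 0 < e / 4 by rewrite divr_gt0.
apply: filterS2 (nearby_oscillation f_osc e4_gt0) (nbhs_infty_gt 0) => n osc n_gt0.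
have /choice [x x_near] : forall m, exists x, nearby n (minn m n) x /\ local_sup n m - e / 4 < f x.
  by move=> m; have [_ [x ? <-] ?] := sup_adherent e4_gt0 (has_sup_local m n_gt0); exists x.
have /choice [y y_near] : forall m, exists y, nearby n (minn m n) y /\ f y < local_inf n m + e / 4.
  by move=> m; have [_ [y ? <-] ?] := inf_adherent e4_gt0 (has_inf_local m n_gt0); exists y.
have x_osc : n%:R^-1 * \sum_(m < n) `|f (x m) - f (m%:R / n%:R)| < e / 4.
  by apply: osc => m mn; have [+ _] := x_near m; rewrite (minn_idPl (ltnW mn)).
have y_osc : n%:R^-1 * \sum_(m < n) `|f (y m) - f (m%:R / n%:R)| < e / 4.
  by apply: osc => m mn; have [+ _] := y_near m; rewrite (minn_idPl (ltnW mn)).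
apply: (@le_lt_trans _ _ (n%:R^-1 * \sum_(m < n) (`|f (x m) - f (m%:R / n%:R)| +
    `|f (y m) - f (m%:R / n%:R)| + e / 2))).
  rewrite ler_wpM2l ?invr_ge0 //; apply: ler_sum => m _.
  have [_ fx_gt] := x_near m; have [_ fy_lt] := y_near m.
  have := ler_norm (f (x m) - f (m%:R / n%:R)); have := ler_norm (f (m%:R / n%:R) - f (y m)).
  rewrite [`|f (y m) - _|]distrC; lra.
rewrite big_split /= big_split /= sumr_const card_ord -[(e / 2) *+ n]mulr_natl !mulrDr.
rewrite mulKf ?pnatr_eq0 -?lt0n //; lra.
Qed.

End LocalBounds.

Lemma prod_diff_le (I : eqType) (s : seq I) (L U : I -> R) K : 1 <= K ->
  (forall e, 0 <= L e) -> (forall e, L e <= U e) -> (forall e, U e <= K) ->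
  \prod_(e <- s) U e - \prod_(e <- s) L e <= K ^+ size s * \sum_(e <- s) (U e - L e).
Proof.
move=> K_ge1 L_ge0 LU UK; have U_ge0 e : 0 <= U e := le_trans (L_ge0 e) (LU e).
have K_ge0 : 0 <= K by exact: le_trans K_ge1.
have prodL_le (t : seq I) : \prod_(j <- t) L j <= K ^+ size t.
  elim: t => [|j t IH] /=; first by rewrite big_nil.
  by rewrite big_cons exprS ler_pM ?prodr_ge0 // (le_trans (LU j)).
elim: s => [|e s IH]; first by rewrite !big_nil subrr mulr0.
have prodL_ge0 : 0 <= \prod_(j <- s) L j by rewrite prodr_ge0.
have prod_mono : 0 <= \prod_(j <- s) U j - \prod_(j <- s) L j.
  by rewrite subr_ge0; apply: ler_prod => j _; rewrite L_ge0 LU.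
rewrite !big_cons /=.
have -> : U e * \prod_(j <- s) U j - L e * \prod_(j <- s) L j =
  (U e - L e) * \prod_(j <- s) L j + U e * (\prod_(j <- s) U j - \prod_(j <- s) L j) by ring.
rewrite [leRHS]mulrDr; apply: lerD.
  rewrite mulrC ler_wpM2r ?subr_ge0 // (le_trans (prodL_le s)) //.
  by rewrite exprS ler_peMl // exprn_ge0.
by rewrite exprS -mulrA ler_pM.
Qed.

Section CubeRiemannSums.
Variables (f : R -> R) (K : R) (n : nat) (E : seq (nat * nat)).
Hypothesis f_ge0 : forall x, 0 <= f x.
Hypothesis f_le : forall x : R, 0 <= x <= 1 -> f x <= K.
Hypothesis f_osc : vanishing_oscillation f.
Hypothesis E_loopless : forall e, e \in E -> [/\ (e.1 < n)%N, (e.2 < n)%N & e.1 != e.2].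

Definition edge_prod (x : seq R) := \prod_(e <- E) f `|nth 0 x e.1 - nth 0 x e.2|.

Let lower N (a : seq nat) := \prod_(e <- E) local_inf f N `|nth 0%N a e.1 - nth 0%N a e.2|%N.
Let upper N (a : seq nat) := \prod_(e <- E) local_sup f N `|nth 0%N a e.1 - nth 0%N a e.2|%N.

Let edge_prod_bounds N a x : (0 < N)%N -> size a = n -> in_cells N a x ->
  lower N a <= edge_prod x <= upper N a.
Proof.
move=> N_gt0 sa [sax ax]; rewrite /lower /upper /edge_prod.
rewrite big_seq [X in _ <= X <= _]big_seq [X in _ <= _ <= X]big_seq.
have bounds e : e \in E -> local_inf f N `|nth 0%N a e.1 - nth 0%N a e.2|%N <=
      f `|nth 0 x e.1 - nth 0 x e.2| <= local_sup f N `|nth 0%N a e.1 - nth 0%N a e.2|%N.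
  move=> /E_loopless [e1n e2n _]; rewrite -sa in e1n e2n.
  have [a1N x1] := ax _ e1n; have [a2N x2] := ax _ e2n.
  by apply: (local_bounds f_ge0 f_le N_gt0); [lia | exact: nearby_cells].
apply/andP; split; apply: ler_prod => e /bounds /andP [inf_le le_sup].
  by rewrite local_inf_ge0.
by rewrite f_ge0.
Qed.

Let avg_gap (eps : R) : 0 < eps -> \forall N \near \oo,
  cube_avg N n (upper N) - cube_avg N n (lower N) < eps.
Proof.
move=> eps_gt0; pose K1 := K + 1.
have K_ge0 : 0 <= K by apply: le_trans (f_le (x := 0) _); rewrite ?lexx ?ler01.
have K1_ge1 : 1 <= K1 by rewrite lerDr.
have KE_ge0 : 0 <= K1 ^+ size E by rewrite exprn_ge0 // (le_trans _ K1_ge1).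
pose M := K1 ^+ size E * ((size E)%:R * 2) + 1.
have M_gt0 : 0 < M by rewrite ltr_wpDl // !mulr_ge0.
have osc_small := avg_local_oscillation f_ge0 f_le f_osc (divr_gt0 eps_gt0 M_gt0).
apply: filterS2 osc_small (nbhs_infty_gt 0) => N osc N_gt0.
pose w m := local_sup f N m - local_inf f N m.
have w_ge0 m : 0 <= w m by rewrite subr_ge0 (local_inf_le_sup f_ge0 f_le).
rewrite -cube_avgB; apply: (@le_lt_trans _ _ (cube_avg N n (fun a => K1 ^+ size E *
    \sum_(e <- E) w `|nth 0%N a e.1 - nth 0%N a e.2|%N))).
  apply: le_cube_avg => a _ _; apply: prod_diff_le => // e.
  - exact: local_inf_ge0.
  - exact: (local_inf_le_sup f_ge0 f_le).
  - by rewrite (le_trans (local_sup_le f_le _ N_gt0)) // lerDl.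
rewrite cube_avgZ cube_avg_sum.
apply: (@le_lt_trans _ _ (K1 ^+ size E * \sum_(e <- E) (2 * (eps / M)))).
  rewrite ler_wpM2l // big_seq [leRHS]big_seq; apply: ler_sum => e /E_loopless [e1n e2n e_neq].
  by rewrite (le_trans (cube_avg_dist_le N_gt0 e1n e2n e_neq w_ge0)) // ler_wpM2l // ltW.
rewrite big_const_seq count_predT iter_addr addr0 -[_ *+ _]mulr_natl !mulrA.
by rewrite ltr_pdivrMr // mulrC ltr_pM2l // -mulrA /M ltrDl.
Qed.

Lemma cvg_cube_avg_edge_prod :
  (fun N => cube_avg N n (fun a => edge_prod [seq i%:R / N%:R | i <- a]))
  @ \oo --> fine (cube_int n (fun x => (edge_prod x)%:E)).
Proof.
set J := cube_int _ _; apply/cvgrPdist_lt => eps eps_gt0.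
apply: filterS2 (avg_gap eps_gt0) (nbhs_infty_gt 0) => N gap N_gt0.
have prod_ge0 x : (0 <= (edge_prod x)%:E)%E by rewrite lee_fin prodr_ge0.
have inf_ge0 m := local_inf_ge0 f_ge0 m N_gt0.
have sup_ge0 m := le_trans (inf_ge0 m) (local_inf_le_sup f_ge0 f_le m N_gt0).
have J_le : (J <= (cube_avg N n (upper N))%:E)%E.
  apply: cube_int_le_avg => // [a|a x sa ax]; first by rewrite prodr_ge0.
  by rewrite lee_fin; case/andP: (edge_prod_bounds N_gt0 sa ax).
have J_ge : ((cube_avg N n (lower N))%:E <= J)%E.
  apply: avg_le_cube_int => // [a|a x sa ax]; first by rewrite prodr_ge0.
  by rewrite lee_fin; case/andP: (edge_prod_bounds N_gt0 sa ax).
have J_fin : J \is a fin_num.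
  by rewrite fin_numElt (lt_le_trans _ J_ge) ?ltNyr // (le_lt_trans J_le) ?ltry.
rewrite -(fineK J_fin) !lee_fin in J_le J_ge.
have grid_bounds a : size a = n -> all (fun i => (i < N)%N) a ->
    lower N a <= edge_prod [seq i%:R / N%:R | i <- a] <= upper N a.
  by move=> sa aN; apply: edge_prod_bounds => //; exact: in_cells_grid.
have avg_le : cube_avg N n (fun a => edge_prod [seq i%:R / N%:R | i <- a]) <=
    cube_avg N n (upper N).
  by apply: le_cube_avg => a sa aN; case/andP: (grid_bounds a sa aN).
have avg_ge : cube_avg N n (lower N) <=
    cube_avg N n (fun a => edge_prod [seq i%:R / N%:R | i <- a]).
  by apply: le_cube_avg => a sa aN; case/andP: (grid_bounds a sa aN).
rewrite ltr_norml; lra.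
Qed.

End CubeRiemannSums.
End Oscillation.

(** * Independence and mixed moments *)

Section Moments.
Context (R : realType) (d : measure_display) (T : measurableType d) (P : probability T R).
Implicit Types (Z Y : T -> R).

Definition finite_moments : {pred T -> R} := [pred Z : T -> R |
  `[< measurable_fun setT Z /\ forall n, (\int[P]_w (`|Z w| ^+ n)%:E < +oo)%E >]].

Lemma finite_momentsP Z : reflect
  (measurable_fun setT Z /\ forall n, (\int[P]_w (`|Z w| ^+ n)%:E < +oo)%E)
  (Z \in finite_moments).
Proof. exact: asboolP. Qed.

Lemma finite_moments_measurable Z : Z \in finite_moments -> measurable_fun setT Z.
Proof. by move=> /finite_momentsP []. Qed.

Lemma finite_moments_le Z Y : measurable_fun setT Z -> (forall w, `|Z w| <= `|Y w|) ->
  Y \in finite_moments -> Z \in finite_moments.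
Proof.
move=> mZ ZY /finite_momentsP [_ Y_fin]; apply/finite_momentsP; split=> // n.
apply: le_lt_trans (Y_fin n); apply: ge0_le_integral_nomeas => w _; rewrite lee_fin.
  by rewrite exprn_ge0.
by rewrite lerXn2r ?nnegrE.
Qed.

Lemma finite_moments_cst (c : R) : (fun=> c) \in finite_moments.
Proof.
apply/finite_momentsP; split=> [|n]; first exact: measurable_cst.
by rewrite integral_cst // [X in (_ * X)%E]probability_setT mule1 ltry.
Qed.

Lemma finite_moments_bounded Z (c : R) : measurable_fun setT Z ->
  (forall w, `|Z w| <= c) -> Z \in finite_moments.
Proof.
move=> mZ Zc; apply: (finite_moments_le mZ) (finite_moments_cst c) => w.
by rewrite (le_trans (Zc w)) // ler_norm.
Qed.

Lemma finite_moments_normr Z : Z \in finite_moments -> (fun w => `|Z w|) \in finite_moments.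
Proof.
move=> Z_mom; apply: (finite_moments_le _ _ Z_mom) => [|w]; last by rewrite normr_id.
by apply: measurableT_comp => //; exact: finite_moments_measurable.
Qed.

Let integralD_lty (f g : T -> \bar R) : measurable_fun setT f -> measurable_fun setT g ->
  (forall w, 0 <= f w)%E -> (forall w, 0 <= g w)%E ->
  (\int[P]_w f w < +oo)%E -> (\int[P]_w g w < +oo)%E -> (\int[P]_w (f w + g w) < +oo)%E.
Proof. by move=> *; rewrite ge0_integralD //; exact: lte_add_pinfty. Qed.

Let measurable_normX Z n : measurable_fun setT Z ->
  measurable_fun setT (fun w => (`|Z w| ^+ n)%:E).
Proof. by move=> mZ; apply/measurable_EFinP/measurable_funX; exact: measurableT_comp. Qed.

Lemma finite_momentsB Z Y : Z \in finite_moments -> Y \in finite_moments ->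
  (fun w => Z w - Y w) \in finite_moments.
Proof.
move=> /finite_momentsP [mZ Z_fin] /finite_momentsP [mY Y_fin].
apply/finite_momentsP; split=> [|n]; first exact: measurable_funB.
apply: (@le_lt_trans _ _
  (\int[P]_w ((2 ^+ n)%:E * ((`|Z w| ^+ n)%:E + (`|Y w| ^+ n)%:E)))%E).
  apply: ge0_le_integral_nomeas => w _; first by rewrite lee_fin exprn_ge0.
  rewrite -EFinD -EFinM lee_fin mulrDr -!exprMn.
  apply: (@le_trans _ _ ((2 * Num.max `|Z w| `|Y w|) ^+ n)).
    rewrite lerXn2r ?nnegrE ?mulr_ge0 ?le_max ?normr_ge0 //.
    rewrite (le_trans (ler_normB _ _)) // mulr_natl mulr2n.
    by rewrite lerD // le_max lexx ?orbT.
  by case: (leP `|Z w|) => _; [rewrite lerDr|rewrite lerDl]; rewrite exprn_ge0 // mulr_ge0.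
rewrite ge0_integralZl ?lee_fin ?exprn_ge0 //.
- rewrite lte_mul_pinfty ?lee_fin ?exprn_ge0 // integralD_lty //.
  + exact: measurable_normX.
  + exact: measurable_normX.
- by apply: emeasurable_funD; exact: measurable_normX.
- by move=> w _; rewrite -EFinD lee_fin addr_ge0 ?exprn_ge0.
Qed.

Lemma finite_momentsM Z Y : Z \in finite_moments -> Y \in finite_moments ->
  (fun w => Z w * Y w) \in finite_moments.
Proof.
move=> /finite_momentsP [mZ Z_fin] /finite_momentsP [mY Y_fin].
apply/finite_momentsP; split=> [|n]; first exact: measurable_funM.
apply: (@le_lt_trans _ _
  (\int[P]_w ((`|Z w| ^+ (n * 2))%:E + (`|Y w| ^+ (n * 2))%:E))%E).
  apply: ge0_le_integral_nomeas => w _; first by rewrite lee_fin exprn_ge0.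
  rewrite -EFinD lee_fin normrM exprMn !exprM.
  have : 0 <= (`|Z w| ^+ n - `|Y w| ^+ n) ^+ 2 by rewrite sqr_ge0.
  have : 0 <= `|Z w| ^+ n * `|Y w| ^+ n by rewrite mulr_ge0 ?exprn_ge0.
  nra.
by apply: integralD_lty => //; exact: measurable_normX.
Qed.

Lemma finite_moments_subring : subring_closed finite_moments.
Proof.
by split; [exact: finite_moments_cst | exact: finite_momentsB | exact: finite_momentsM].
Qed.

HB.instance Definition _ :=
  GRing.isSubringClosed.Build (T -> R) finite_moments finite_moments_subring.

Lemma finite_momentsX Z n : Z \in finite_moments -> (fun w => Z w ^+ n) \in finite_moments.
Proof. by move=> /(rpredX n); rewrite exprfctE. Qed.

Lemma finite_moments_prod (I : Type) (s : seq I) (Q : pred I) (F : I -> T -> R) :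
  (forall i, F i \in finite_moments) -> (fun w => \prod_(i <- s | Q i) F i w) \in finite_moments.
Proof. by move=> F_mom; rewrite -fct_prodE rpred_prod. Qed.

Lemma finite_moments_sum (I : Type) (s : seq I) (F : I -> T -> R) :
  (forall i, F i \in finite_moments) -> (fun w => \sum_(i <- s) F i w) \in finite_moments.
Proof. by move=> F_mom; rewrite -fct_sumE rpred_sum. Qed.

Lemma finite_moments_indic (X : {RV P >-> R}) (B : set R) : measurable B ->
  (fun w => \1_B (X w)) \in finite_moments.
Proof.
move=> mB; apply: (@finite_moments_bounded _ 1) => [|w].
  by apply: measurableT_comp => //; exact: measurable_indic.
by rewrite indicE; case: (_ \in _); rewrite ?normr1 ?normr0.
Qed.

Lemma finite_moments_integrable Z : Z \in finite_moments -> P.-integrable setT (EFin \o Z).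
Proof.
move=> /finite_momentsP [mZ /(_ 1%N) Z_fin]; apply/integrableP; split; first exact/measurable_EFinP.
by move: Z_fin; under eq_integral do rewrite expr1.
Qed.

Lemma Rintegral_sum (I : Type) (s : seq I) (F : I -> T -> R) :
  (forall i, F i \in finite_moments) ->
  \int[P]_w (\sum_(i <- s) F i w) = \sum_(i <- s) \int[P]_w F i w.
Proof.
move=> F_mom; elim: s => [|i s IH].
  by under eq_Rintegral do rewrite big_nil; rewrite Rintegral_cst // mul0r big_nil.
under eq_Rintegral do rewrite big_cons.
by rewrite RintegralD ?finite_moments_integrable ?finite_moments_sum // IH big_cons.
Qed.

Section TestFunctions.
Import HBNNSimple.
Variable X : {RV P >-> R}.

Let values (h : {nnsfun R >-> R}) : seq R := finmap.enum_fset (fset_set (range h)).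

Let Rintegral_sfun Y (h : {nnsfun R >-> R}) : Y \in finite_moments ->
  \int[P]_w (h (X w) * Y w) = \sum_(i < size (values h)) (values h)`_i *
     \int[P]_w (\1_(h @^-1` [set (values h)`_i]) (X w) * Y w).
Proof.
move=> Y_mom; set s := values h.
have mom i : (fun w => \1_(h @^-1` [set s`_i]) (X w) * Y w) \in finite_moments.
  by apply: finite_momentsM => //; apply: finite_moments_indic.
under eq_Rintegral do rewrite fimfunEord mulr_suml.
under eq_Rintegral do under eq_bigr do rewrite -mulrA.
rewrite Rintegral_sum => [|i]; last by rewrite finite_momentsM ?finite_moments_cst.
by apply: eq_bigr => i _; rewrite RintegralZl // finite_moments_integrable.
Qed.

Let cvg_Rintegral_approx (f : R -> R) (mf : measurable_fun setT (EFin \o f)) Y :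
  (forall x, 0 <= f x) -> (fun w => f (X w)) \in finite_moments -> Y \in finite_moments ->
  (fun n => \int[P]_w (nnsfun_approx measurableT mf n (X w) * Y w)) @ \oo -->
    \int[P]_w (f (X w) * Y w).
Proof.
move=> f_ge0 fX_mom Y_mom; set h := nnsfun_approx measurableT mf.
have Ef_ge0 x : [set: R] x -> (0 <= (EFin \o f) x)%E by rewrite lee_fin.
have h_le n x : h n x <= f x.
  by rewrite -lee_fin /h nnsfun_approxE; apply: (le_approx (D := setT) (f := EFin \o f)).
have h_cvg x : h n x @[n --> \oo] --> f x.
  exact: (fine_cvg (cvg_nnsfun_approx measurableT mf Ef_ge0 (I : setT x))).
have fXY_mom := finite_momentsM fX_mom Y_mom.
have hXY_mom n : (fun w => h n (X w) * Y w) \in finite_moments.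
  apply: finite_momentsM => //; apply: (finite_moments_le _ _ fX_mom) => [|w].
    exact: measurableT_comp.
  by rewrite !ger0_norm.
apply: (@fine_cvg _ _ _ _ (fun n => \int[P]_w (h n (X w) * Y w)%:E)%E).
rewrite fineK; last exact/integrable_fin_num/finite_moments_integrable.
have [|||||_ _ //] := @dominated_convergence _ _ _ P setT measurableT
  (fun n w => (h n (X w) * Y w)%:E) (fun w => (f (X w) * Y w)%:E)
  (fun w => `|(f (X w) * Y w)%:E|%E).
- by move=> n; apply/measurable_EFinP/finite_moments_measurable.
- exact/measurable_EFinP/finite_moments_measurable.
- apply: aeW => w _; apply: cvg_EFin; first exact: nearW.
  by apply: cvgMr_tmp; exact: h_cvg.
- exact/integrable_abse/finite_moments_integrable.
- by apply: aeW => w n _; rewrite lee_fin !normrM ler_wpM2r // !ger0_norm.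
Qed.

Variables (G H : T -> R) (K : R).
Hypotheses (G_mom : G \in finite_moments) (H_mom : H \in finite_moments).
Hypothesis indicGH : forall B : set R, measurable B ->
  \int[P]_w (\1_B (X w) * G w) = (\int[P]_w (\1_B (X w) * H w)) * K.

Let Rintegral_test_ge0 (f : R -> R) : measurable_fun setT f -> (forall x, 0 <= f x) ->
  (fun w => f (X w)) \in finite_moments ->
  \int[P]_w (f (X w) * G w) = (\int[P]_w (f (X w) * H w)) * K.
Proof.
move=> /measurable_EFinP mf f_ge0 fX_mom.
have G_cvg := cvg_Rintegral_approx mf f_ge0 fX_mom G_mom.
have H_cvg : (fun n => (\int[P]_w (nnsfun_approx measurableT mf n (X w) * H w)) * K) @ \oo -->
    (\int[P]_w (f (X w) * H w)) * K.
  by apply: cvgMr_tmp; exact: cvg_Rintegral_approx.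
apply: (cvg_unique _ G_cvg); first exact: norm_hausdorff.
apply: cvg_trans H_cvg; apply: near_eq_cvg; apply: nearW => n.
rewrite !Rintegral_sfun // mulr_suml; apply: eq_bigr => i _.
by rewrite indicGH // mulrA.
Qed.

Lemma Rintegral_test (f : R -> R) : measurable_fun setT f ->
  (fun w => f (X w)) \in finite_moments ->
  \int[P]_w (f (X w) * G w) = (\int[P]_w (f (X w) * H w)) * K.
Proof.
move=> mf fX_mom.
have part_mom (f' : R -> R) : measurable_fun setT f' -> (forall x, `|f' x| <= `|f x|) ->
    (fun w => f' (X w)) \in finite_moments.
  move=> mf' f'_le; apply: (finite_moments_le _ _ fX_mom) => //.
  exact: measurableT_comp.
have pos_mom : (fun w => f^\+ (X w)) \in finite_moments.
  apply: part_mom => [|x]; first exact: measurable_funrpos.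
  by rewrite ger0_norm ?funrpos_ge0 // /funrpos ge_max ler_norm normr_ge0.
have neg_mom : (fun w => f^\- (X w)) \in finite_moments.
  apply: part_mom => [|x]; first exact: measurable_funrneg.
  by rewrite ger0_norm ?funrneg_ge0 // /funrneg ge_max -normrN ler_norm normr_ge0.
have split_test Y : Y \in finite_moments -> \int[P]_w (f (X w) * Y w) =
    \int[P]_w (f^\+ (X w) * Y w) - \int[P]_w (f^\- (X w) * Y w).
  move=> Y_mom; rewrite -RintegralB ?finite_moments_integrable ?finite_momentsM //.
  by apply: eq_Rintegral => w _; rewrite -mulrBl -[in LHS](funrposBneg f).
rewrite !split_test // mulrBl !Rintegral_test_ge0 //.
- exact: measurable_funrneg.
- exact: measurable_funrpos.
Qed.

End TestFunctions.

Section Independence.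
Variables (I : finType) (X : I -> {RV P >-> R}) (classes : {set {set I}}).
Hypothesis classesP : finset.partition classes [set: I]%SET.
Hypothesis indep : forall B : I -> set R, (forall q, measurable (B q)) ->
  P (\bigcap_(q in [set: I]) (X q @^-1` B q)) =
  (\prod_(C in classes) P (\bigcap_(q in [set q | q \in C]) (X q @^-1` B q)))%E.
Implicit Types (F : I -> T -> R) (B : I -> set R).

Definition factorizes F := \int[P]_w (\prod_q F q w) =
  \prod_(C in classes) \int[P]_w (\prod_(q in C) F q w).

Lemma factorizes_indic B : (forall q, measurable (B q)) ->
  factorizes (fun q w => \1_(B q) (X q w)).
Proof.
move=> mB.
have m_cap (A : {set I}) : measurable (\bigcap_(q in [set q | q \in A]) (X q @^-1` B q)).
  apply: fin_bigcap_measurable; first exact: finite_finset.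
  by move=> q _; rewrite -[_ @^-1` _]setTI; exact: measurable_funPT.
have prod_indic (A : {set I}) : (\int[P]_w (\prod_(q in A) \1_(B q) (X q w)))%:E =
    P (\bigcap_(q in [set q | q \in A]) (X q @^-1` B q)).
  set D := \bigcap_(_ in _) _; have mD : measurable D := m_cap A.
  rewrite -[P D]fineK ?fin_num_measure // -(setIT D) -integral_indic //.
  congr EFin; congr fine; apply: eq_integral => w _; congr EFin; rewrite indicE.
  have [/set_mem w_in|w_out] := boolP (w \in D).
    by rewrite big1 // => q qA; rewrite indicE mem_set //; exact: w_in.
  have [q qA qw] : exists2 q, q \in A & ~ B q (X q w).
    apply: contrapT => noq; move/negP: w_out; apply; apply: mem_set => q /= qA.
    by apply: contrapT => Bq; apply: noq; exists q.
  by rewrite (bigD1 q) //= indicE memNset // mul0r.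
apply: EFin_inj; rewrite (big_morph EFin EFinM erefl).
rewrite (eq_bigr _ (fun C _ => prod_indic C)) -indep //.
have -> : [set: I] = [set q | q \in [set: I]%SET] by apply/seteqP; split=> q //= _; rewrite inE.
rewrite -prod_indic; congr (fine _)%:E; apply: eq_integral => w _.
by under [in RHS]eq_bigl do rewrite inE.
Qed.

(* By independence the law of [X q0] enters both sides linearly, so an identity that holds for
   all its indicators extends to every test function. *)
Lemma factorizes_replace F q0 (f : R -> R) : (forall q, F q \in finite_moments) ->
  measurable_fun setT f -> (fun w => f (X q0 w)) \in finite_moments ->
  (forall B : set R, measurable B ->
    factorizes (fun q => if q == q0 then fun w => \1_B (X q0 w) else F q)) ->
  factorizes (fun q => if q == q0 then fun w => f (X q0 w) else F q).
Proof.
move=> F_mom mf fX_mom; pose subst Y q := if q == q0 then Y else F q.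
have /and3P [/eqP cover_classes classes_triv _] := classesP.
pose C0 := finset.pblock classes q0.
have q0C0 : q0 \in C0 by rewrite mem_pblock cover_classes inE.
have C0_in : C0 \in classes by rewrite pblock_mem // cover_classes inE.
pose K := \prod_(C in classes | C != C0) \int[P]_w (\prod_(q in C) F q w).
have substE Y (Q : pred I) w : Q q0 ->
    \prod_(q | Q q) subst Y q w = Y w * \prod_(q | Q q && (q != q0)) F q w.
  move=> Qq0; rewrite (bigD1 q0) //= /subst eqxx; congr (_ * _).
  by apply: eq_bigr => q /andP [_ /negbTE ->].
have factorizesE Y : factorizes (subst Y) <->
    \int[P]_w (Y w * \prod_(q | q != q0) F q w) =
    (\int[P]_w (Y w * \prod_(q in C0 | q != q0) F q w)) * K.
  have prodT : \int[P]_w (\prod_q subst Y q w) = \int[P]_w (Y w * \prod_(q | q != q0) F q w).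
    by apply: eq_Rintegral => w _; exact: (substE Y xpredT).
  have prodC0 : \int[P]_w (\prod_(q in C0) subst Y q w) =
      \int[P]_w (Y w * \prod_(q in C0 | q != q0) F q w).
    by apply: eq_Rintegral => w _; exact: (substE Y [in C0]).
  rewrite /factorizes prodT [\prod_(C in classes) _](bigD1 C0) //= prodC0.
  rewrite (eq_bigr (fun C : {set I} => \int[P]_w (\prod_(q in C) F q w))) // => C /andP [CC CC0].
  apply: eq_Rintegral => w _; apply: eq_bigr => q qC; rewrite /subst.
  have [q_eq|//] := eqVneq q q0; rewrite q_eq in qC.
  by rewrite -(finset.def_pblock classes_triv CC qC) eqxx in CC0.
move=> indicF; apply/factorizesE.
apply: Rintegral_test => // [||B mB]; [exact: finite_moments_prod..|].
exact/factorizesE/indicF.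
Qed.

Lemma indep_prod (f : I -> R -> R) : (forall q, measurable_fun setT (f q)) ->
  (forall q, (fun w => f q (X q w)) \in finite_moments) ->
  factorizes (fun q w => f q (X q w)).
Proof.
move=> mf fX_mom.
pose partial (S : seq I) B q w := if q \in S then f q (X q w) else \1_(B q) (X q w).
have partial_mom S B q : (forall q, measurable (B q)) -> partial S B q \in finite_moments.
  move=> mB; rewrite /partial; case: (q \in S) => //; exact: finite_moments_indic.
suff factorizes_partial S B : (forall q, measurable (B q)) -> factorizes (partial S B).
  rewrite (_ : (fun q w => _) = partial (enum I) (fun=> setT)); first exact: factorizes_partial.
  by apply/funext => q; apply/funext => w; rewrite /partial mem_enum.
elim: S B => [|q0 S IH] B mB; first exact: factorizes_indic.
have [q0S|q0S] := boolP (q0 \in S).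
  rewrite (_ : partial _ _ = partial S B); first exact: IH.
  apply/funext => q; apply/funext => w; rewrite /partial inE.
  by case: eqVneq => [->|] //=; rewrite q0S.
rewrite (_ : partial _ _ = fun q => if q == q0 then fun w => f q0 (X q0 w) else partial S B q).
  apply: factorizes_replace => // [q|D mD]; first exact: partial_mom.
  rewrite (_ : (fun q => _) = partial S (fun q => if q == q0 then D else B q)).
    by apply: IH => q; case: ifP.
  apply/funext => q; apply/funext => w; rewrite /partial.
  by case: eqVneq => [->|] //; rewrite (negbTE q0S).
apply/funext => q; apply/funext => w; rewrite /partial inE.
by case: eqVneq => [->|].
Qed.

End Independence.

End Moments.

(** * The trace expansion *)

Section TraceExpansion.
Variables (R : comPzRingType) (N : nat) (M : 'M[R]_N) (x0 : 'I_N).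

Lemma expmx_walks n a b : (M ^+ n.+1) a b = \sum_(w : n.-tuple 'I_N)
  \prod_(j < n.+1) M (nth x0 (a :: w) j) (nth x0 (rcons w b) j).
Proof.
elim: n a b => [|n IH] a b; first by rewrite big_tuple0 big_ord1.
rewrite exprS -mulmxE mxE big_tuple_cons; apply: eq_bigr => c _.
by rewrite IH mulr_sumr; apply: eq_bigr => w _; rewrite [RHS]big_ord_recl.
Qed.

Lemma trace_expmx k : (0 < k)%N -> \tr (M ^+ k) = \sum_(i : k.-tuple 'I_N)
  \prod_(j < k) M (edge x0 i j).1 (edge x0 i j).2.
Proof.
case: k => // n _; rewrite /mxtrace big_tuple_cons; apply: eq_bigr => a _.
rewrite expmx_walks; apply: eq_bigr => w _; apply: eq_bigr => -[j jn] _.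
rewrite /edge /= size_tuple; congr (M _ _).
move: jn; rewrite ltnS leq_eqVlt => /predU1P [->|jn].
  by rewrite modnn nth_rcons size_tuple ltnn eqxx.
by rewrite modn_small //= nth_rcons size_tuple jn.
Qed.

End TraceExpansion.

Lemma prodr_le_sum_exp (R : realFieldType) k (x : 'I_k -> R) : (0 < k)%N ->
  (forall j, 0 <= x j) -> \prod_(j < k) x j <= \sum_(j < k) x j ^+ k.
Proof.
case: k x => // k x _ x_ge0.
case: (@Order.TotalTheory.arg_maxP _ _ _ ord0 xpredT x isT) => j0 _ x_max.
apply: (@le_trans _ _ (x j0 ^+ k.+1)).
  rewrite -[in leRHS](card_ord k.+1) -prodr_const.
  by apply: ler_prod => j _; rewrite x_ge0; exact: x_max.
by rewrite (bigD1 j0) //= lerDl sumr_ge0 // => j _; rewrite exprn_ge0.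
Qed.

Lemma folds_ppseq_flip (T : eqType) (x0 : T) k (p : {ffun 'I_k -> 'I_k}) (i : seq T) (j : 'I_k) :
  is_pairing p -> folds x0 (ppseq p) i ->
  edge x0 i (p j) = ((edge x0 i j).2, (edge x0 i j).1).
Proof.
move=> /pairing_ppseq pP i_folds; rewrite -nth_ppseq.
by apply: (folds_edge_flip pP i_folds); rewrite size_ppseq.
Qed.

Section RandomMatrix.
Context (R : realType) (d : measure_display) (T : measurableType d) (P : probability T R).
Variables (N : nat) (x0 : 'I_N) (X : 'I_N -> 'I_N -> {RV P >-> R}) (r : rel ('I_N * 'I_N)).
Variables (Rk : nat -> R) (k : nat).
Hypothesis X_sym : forall i j w, X i j w = X j i w.
Hypothesis X_mean : forall i j, ('E_P[X i j] = 0)%E.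
Hypothesis X_var : forall i j, ('E_P[fun w => (X i j w ^+ 2)%R] = 1)%E.
Hypothesis X_moments : forall n i j, ('E_P[fun w => (`|X i j w| ^+ n)%R] <= (Rk n)%:E)%E.
Hypothesis r_equiv : equivalence_rel r.
Hypothesis r_flip : forall p q : 'I_N, r (p, q) (q, p).
Hypothesis r_indep : indep_classes X r.
Hypothesis k_gt0 : (0 < k)%N.
Implicit Types (i : k.-tuple 'I_N) (p : {ffun 'I_k -> 'I_k}).

Local Notation Y := (fun q : 'I_N * 'I_N => X q.1 q.2).

Let RintegralE (Z : T -> R) : \int[P]_w Z w = fine ('E_P[Z])%E.
Proof. by rewrite unlock. Qed.

Lemma entry_moments (a b : 'I_N) : (X a b : T -> R) \in finite_moments P.
Proof.
apply/finite_momentsP; split=> [|n]; first exact: measurable_funPT.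
by have := X_moments n a b; rewrite unlock => /le_lt_trans; apply; rewrite ltry.
Qed.

Definition mixed_moment i : R := \int[P]_w (\prod_(j < k) Y (edge x0 i j) w).

Let prod_by_edge i (A : {set 'I_N * 'I_N}) (F : 'I_N * 'I_N -> R) :
  \prod_(q in A) F q ^+ #|[pred j : 'I_k | edge x0 i j == q]| =
  \prod_(j < k | edge x0 i j \in A) F (edge x0 i j).
Proof.
rewrite [RHS](partition_big (fun j : 'I_k => edge x0 i j) [in A]) //=.
apply: eq_bigr => q qA; rewrite -prodr_const; apply: eq_big => [j|j].
  by rewrite inE; case: eqVneq => [->|]; rewrite ?qA ?andbF.
by rewrite inE => /eqP ->.
Qed.

Let classes : {set {set 'I_N * 'I_N}} := [set [set q | r p q] | p : 'I_N * 'I_N]%SET.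

Let classes_partition : finset.partition classes [set: 'I_N * 'I_N]%SET.
Proof.
have := @equivalence_partitionP _ r [set: 'I_N * 'I_N]%SET (fun x y z _ _ _ => r_equiv x y z).
have -> // : equivalence_partition r [set: 'I_N * 'I_N]%SET = classes.
rewrite /classes /equivalence_partition.
have -> : (fun q => [set q' in [set: 'I_N * 'I_N] | r q q']%SET) = fun q => [set q' | r q q']%SET.
  by apply/funext => q; apply/finset.setP => q'; rewrite !inE.
by apply/finset.setP => A; apply/imsetP/imsetP => -[q _ ->]; exists q.
Qed.

Lemma mixed_moment_classes i : mixed_moment i = \prod_(C in classes)
  \int[P]_w (\prod_(j < k | edge x0 i j \in C) Y (edge x0 i j) w).
Proof.
pose f (q : 'I_N * 'I_N) (x : R) := x ^+ #|[pred j : 'I_k | edge x0 i j == q]|.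
have mf q : measurable_fun setT (f q) by exact: measurable_funX.
have f_mom q : (fun w => f q (Y q w)) \in finite_moments P.
  exact/finite_momentsX/entry_moments.
have := indep_prod classes_partition r_indep mf f_mom; rewrite /factorizes /f.
rewrite (_ : Rintegral _ _ _ = mixed_moment i) => [->|].
  by apply: eq_bigr => C _; apply: eq_Rintegral => w _; exact: prod_by_edge.
apply: eq_Rintegral => w _; have := prod_by_edge i [set: _]%SET (fun q => Y q w).
rewrite (eq_bigl xpredT) => [->|q]; last by rewrite finset.in_setT.
by apply: eq_bigl => j; rewrite finset.in_setT.
Qed.

Lemma mixed_moment_isolated i j : edge_class x0 r i j = [set j]%SET -> mixed_moment i = 0.
Proof.
move=> classE; rewrite mixed_moment_classes.
rewrite (bigD1 [set q | r (edge x0 i j) q]%SET) /= ?imset_f //.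
rewrite (_ : \int[P]_w _ = \int[P]_w (Y (edge x0 i j) w)); first by rewrite RintegralE X_mean mul0r.
apply: eq_Rintegral => w _; apply: big_pred1 => l.
by have /finset.setP/(_ l) := classE; rewrite !inE.
Qed.

Lemma mixed_moment_paired i p : is_pairing p ->
  (forall j, edge_class x0 r i j = [set j; p j]%SET) ->
  (forall j : 'I_k, edge x0 i (p j) = ((edge x0 i j).2, (edge x0 i j).1)) ->
  mixed_moment i = 1.
Proof.
move=> /is_pairingP pP classE flip.
rewrite mixed_moment_classes big1 // => _ /imsetP [q _ ->].
have [/existsP [j qj]|/existsPn q_out] := boolP [exists j : 'I_k, r q (edge x0 i j)].
  rewrite (_ : \int[P]_w _ = \int[P]_w (Y (edge x0 i j) w ^+ 2)).
    by rewrite RintegralE X_var.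
  apply: eq_Rintegral => w _; have [p_neq _] := pP j.
  rewrite (eq_bigl [in [set j; p j]%SET]) => [|l]; last first.
    by rewrite -classE !inE (equivalence_rel_left_trans r_equiv qj).
  rewrite finset.big_setU1 /= ?inE 1?eq_sym // finset.big_set1.
  by have [-> ->] := flip j; rewrite [X in _ * X]X_sym expr2.
rewrite (_ : \int[P]_w _ = \int[P]_w 1).
  by rewrite Rintegral_cst // [X in fine X]probability_setT mulr1.
by apply: eq_Rintegral => w _; rewrite big1 // => j; rewrite inE (negbTE (q_out j)).
Qed.

Lemma mixed_moment_bound i : `|mixed_moment i| <= k%:R * Rk k.
Proof.
have prod_mom : (fun w => \prod_(j < k) Y (edge x0 i j) w) \in finite_moments P.
  by apply: finite_moments_prod => j; exact: entry_moments.
have pow_mom (j : 'I_k) : (fun w => `|Y (edge x0 i j) w| ^+ k) \in finite_moments P.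
  exact/finite_momentsX/finite_moments_normr/entry_moments.
have sum_le : \int[P]_w (\sum_(j < k) `|Y (edge x0 i j) w| ^+ k) <= k%:R * Rk k.
  have -> : k%:R * Rk k = \sum_(j < k) Rk k by rewrite sumr_const card_ord mulr_natl.
  rewrite Rintegral_sum //; apply: ler_sum => j _; rewrite -lee_fin RintegralE fineK ?X_moments //.
  by rewrite unlock; apply: integrable_fin_num => //; exact: finite_moments_integrable.
apply: le_trans sum_le; apply: le_trans (le_normr_Rintegral _ _) _ => //.
  exact: finite_moments_integrable.
apply: le_Rintegral => // [||w _].
- exact/finite_moments_integrable/finite_moments_normr.
- exact/finite_moments_integrable/finite_moments_sum.
- by rewrite normr_prod prodr_le_sum_exp.
Qed.

Variables (alpha : R -> R) (C : R).
Hypothesis alpha_le : forall x : R, 0 <= x <= 1 -> `|alpha x| <= C.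
Hypothesis C_ge1 : 1 <= C.

Definition weight (q : 'I_N * 'I_N) := alpha (`|q.1%:R - q.2%:R| / N%:R).

Lemma weight_flip a b : weight (a, b) = weight (b, a).
Proof. by rewrite /weight /= distrC. Qed.

Lemma weight_bound q : `|weight q| <= C.
Proof.
have N_gt0 : (0 < N)%N by exact: leq_ltn_trans (ltn_ord x0).
apply: alpha_le; rewrite divr_ge0 //= ler_pdivrMr ?ltr0n // mul1r -natr_dist ler_nat.
by have := ltn_ord q.1; have := ltn_ord q.2; lia.
Qed.

Definition trace_term i : R := (\prod_(j < k) weight (edge x0 i j)) * mixed_moment i.

Definition tree_term p (i : seq 'I_N) : R :=
  \prod_(j < k | (j < p j)%N) weight (edge x0 i j) ^+ 2.

Let C_ge0 : 0 <= C. Proof. exact: le_trans C_ge1. Qed.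

Lemma trace_term_bound i : `|trace_term i| <= C ^+ k * (k%:R * Rk k).
Proof.
rewrite /trace_term normrM ler_pM ?mixed_moment_bound //.
rewrite normr_prod -[in leRHS](card_ord k) -prodr_const.
by apply: ler_prod => j _; rewrite normr_ge0 weight_bound.
Qed.

Lemma tree_term_bound p (i : seq 'I_N) : `|tree_term p i| <= (C ^+ 2) ^+ k.
Proof.
rewrite normr_prod; apply: (@le_trans _ _ (\prod_(j < k | (j < p j)%N) C ^+ 2)).
  apply: ler_prod => j _; rewrite normr_ge0 normrX.
  by rewrite lerXn2r ?nnegrE // weight_bound.
rewrite prodr_const ler_weXn2l ?exprn_ege1 // -[leqRHS](card_ord k).
exact: max_card.
Qed.

Let folds_edge_class i p : is_pairing p -> folds x0 (ppseq p) i ->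
  (k <= (nclasses x0 r i).*2)%N -> forall j, edge_class x0 r i j = [set j; p j]%SET.
Proof.
move=> pP i_folds many; have /is_pairingP p_inv := pP.
have pj_in j : p j \in edge_class x0 r i j.
  by rewrite inE (folds_ppseq_flip _ pP i_folds); case: (edge x0 i j) => a b; exact: r_flip.
have classes_gt1 j : (1 < #|edge_class x0 r i j|)%N.
  apply/card_gt1P; exists j, (p j); rewrite ?pj_in ?(mem_edge_class _ r_equiv) //.
  by split=> //; rewrite eq_sym; case: (p_inv j).
have [p' p'P classE] := exists_pairing_of_classes r_equiv classes_gt1 many.
move=> j; rewrite classE; suff -> : p' j = p j by [].
have := pj_in j; rewrite classE !inE.
by have [/negbTE -> _] := p_inv j => /eqP.
Qed.

Let folds_prod_weight i p : is_pairing p -> folds x0 (ppseq p) i ->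
  \prod_(j < k) weight (edge x0 i j) = tree_term p i.
Proof.
move=> pP i_folds; have /is_pairingP p_inv := pP.
have pK : involutive p by move=> j; case: (p_inv j).
rewrite (bigID (fun j : 'I_k => (j < p j)%N)) /= /tree_term.
rewrite [X in _ * X](reindex_inj (inv_inj pK)) /=.
rewrite [X in _ * X](eq_bigl (fun j : 'I_k => (j < p j)%N)) => [|j]; last first.
  rewrite pK -leqNgt leq_eqVlt; have [+ _] := p_inv j.
  by rewrite -(inj_eq val_inj) eq_sym /= => /negbTE ->.
rewrite -big_split /=; apply: eq_bigr => j _; rewrite (folds_ppseq_flip _ pP i_folds) expr2.
by congr (_ * _); rewrite weight_flip; case: (edge x0 i j).
Qed.

Definition folded i p := is_ncpp p && `[< folds x0 (ppseq p) i >].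

Lemma trace_term_folded i p : folded i p -> (k <= (nclasses x0 r i).*2)%N ->
  trace_term i = \sum_(p' | folded i p') tree_term p' i.
Proof.
move=> /andP [/is_ncppP [pP nc] /asboolP i_folds] many.
have classE := folds_edge_class pP i_folds many.
rewrite (big_pred1 p) => [|p']; last first.
  apply/andP/eqP => [[/is_ncppP [p'P _] /asboolP i_folds']|->]; last first.
    by split; [apply/is_ncppP | apply/asboolP].
  apply/ffunP => j; have /finset.setP/(_ (p' j)) := classE j.
  rewrite (folds_edge_class p'P i_folds' many) !inE eqxx orbT.
  by have /is_pairingP/(_ j) [/negbTE -> _] := p'P => /esym/eqP.
rewrite /trace_term (folds_prod_weight pP i_folds) (mixed_moment_paired pP classE) ?mulr1 //.
by move=> j; exact: folds_ppseq_flip.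
Qed.

Lemma trace_term_unfolded i : (forall p, ~~ folded i p) -> (k <= (nclasses x0 r i).*2)%N ->
  (forall p, is_pairing p -> i \notin exceptional x0 r k (ppseq p)) -> trace_term i = 0.
Proof.
move=> unfolded many regular.
have [/forallP classes_gt1|/forallPn [j]] := boolP [forall j, (1 < #|edge_class x0 r i j|)%N].
  have [p pP classE] := exists_pairing_of_classes r_equiv classes_gt1 many.
  case/negP: (regular p pP); rewrite inE; apply/asboolP; split=> [j|[nc i_folds]].
    rewrite size_ppseq => jk; rewrite (nth_ppseq p (Ordinal jk)).
    by have /finset.setP/(_ (p (Ordinal jk))) := classE (Ordinal jk); rewrite !inE eqxx orbT.
  case/negP: (unfolded p); apply/andP; split; last exact/asboolP.
  exact/is_ncppP.
rewrite -leqNgt => class_le1; rewrite /trace_term (@mixed_moment_isolated _ j) ?mulr0 //.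
by apply/eqP; rewrite eq_sym eqEcard finset.sub1set (mem_edge_class _ r_equiv) cards1.
Qed.

Definition error_const : R :=
  C ^+ k * (k%:R * Rk k) + #|{ffun 'I_k -> 'I_k}|%:R * (C ^+ 2) ^+ k.

Lemma error_const_ge0 : 0 <= error_const.
Proof.
have := le_trans (normr_ge0 _) (trace_term_bound [tuple x0 | _ < k]).
by move=> /addr_ge0; apply; rewrite mulr_ge0 // !exprn_ge0.
Qed.

Definition nexceptions : nat :=
  (#|[set i : k.-tuple 'I_N | ((nclasses x0 r i).*2 < k)%N]%SET| +
   \sum_(p : {ffun 'I_k -> 'I_k} | is_pairing p) #|exceptional x0 r k (ppseq p)|)%N.

Lemma trace_term_error i :
  `|trace_term i - \sum_(p | folded i p) tree_term p i| <=
  error_const * (((nclasses x0 r i).*2 < k) +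
    \sum_(p : {ffun 'I_k -> 'I_k} | is_pairing p) (i \in exceptional x0 r k (ppseq p)))%N%:R.
Proof.
set D := _ - _; have D_le : `|D| <= error_const.
  rewrite (le_trans (ler_normB _ _)) // lerD ?trace_term_bound //.
  rewrite (le_trans (ler_norm_sum _ _ _)) // mulr_natl -sumr_const.
  rewrite big_mkcond; apply: ler_sum => p _.
  by case: ifP; rewrite ?tree_term_bound // !exprn_ge0.
have [few|many] := ltnP _ k; first by rewrite (le_trans D_le) // ler_peMr ?error_const_ge0 // ler1n.
have [/existsP [p /andP [pP ip]]|/existsPn regular] := boolP [exists p : {ffun 'I_k -> 'I_k},
    is_pairing p && (i \in exceptional x0 r k (ppseq p))].
  by rewrite (le_trans D_le) // ler_peMr ?error_const_ge0 // ler1n (bigD1 p) //= ip.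
suff -> : D = 0 by rewrite normr0 mulr_ge0 ?error_const_ge0.
have [/existsP [p ip]|/existsPn unfolded] := boolP [exists p, folded i p].
  by rewrite /D (trace_term_folded ip many) subrr.
rewrite /D big_pred0 => [|p]; last exact/negbTE.
rewrite subr0 trace_term_unfolded // => p pP.
by have := regular p; rewrite pP.
Qed.

Lemma sum_trace_term_error :
  `|\sum_i trace_term i - \sum_(p | is_ncpp p)
      \sum_(i : k.-tuple 'I_N | `[< folds x0 (ppseq p) i >]) tree_term p i| <=
  error_const * nexceptions%:R.
Proof.
rewrite (exchange_big_dep xpredT) //= -sumrB.
apply: (le_trans (ler_norm_sum _ _ _)).
apply: (le_trans (ler_sum _ (fun i _ => trace_term_error i))).
rewrite -mulr_sumr -natr_sum ler_wpM2l ?error_const_ge0 // ler_nat big_split /= leq_add //.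
  by rewrite -sum1_card [leqRHS]big_mkcond leq_sum // => i _; rewrite inE.
rewrite exchange_big /= leq_sum // => p _.
by rewrite -sum1_card [leqRHS]big_mkcond.
Qed.

Lemma expected_trace_walks : N%:R^-1 * fine ('E_P[fun w => \tr (Mmat alpha X w ^+ k)])%E =
  N%:R^-1 * (Num.sqrt N%:R)^-1 ^+ k * \sum_i trace_term i.
Proof.
pose c := (Num.sqrt (N%:R : R))^-1.
rewrite -RintegralE -mulrA; congr (_ * _); rewrite mulr_sumr.
have prod_mom i : (fun w => \prod_(j < k) Y (edge x0 i j) w) \in finite_moments P.
  by apply: finite_moments_prod => j; exact: entry_moments.
rewrite (_ : \int[P]_w _ = \int[P]_w (\sum_(i : k.-tuple 'I_N)
    (c ^+ k * \prod_(j < k) weight (edge x0 i j)) * \prod_(j < k) Y (edge x0 i j) w)).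
  rewrite Rintegral_sum => [|i]; last by rewrite finite_momentsM ?finite_moments_cst.
  apply: eq_bigr => i _; rewrite RintegralZl ?finite_moments_integrable //.
  by rewrite /trace_term mulrA.
apply: eq_Rintegral => w _; rewrite (trace_expmx _ x0 k_gt0); apply: eq_bigr => i _.
rewrite -mulrA -big_split /= -[in c ^+ k](card_ord k) -prodr_const -big_split /=.
by apply: eq_bigr => j _; rewrite mxE mulrA.
Qed.

End RandomMatrix.

Section TreeAverages.
Variables (R : realType) (alpha : R -> R) (k : nat) (p : {ffun 'I_k -> 'I_k}).
Hypotheses (p_ncpp : is_ncpp p) (k_gt0 : (0 < k)%N).

Local Notation s := (ppseq p).
Local Notation g := (Gseq (ppseq p)).
Local Notation V := (undup g).

Let sP : pairing s. Proof. by apply: pairing_ppseq; case/is_ncppP: p_ncpp. Qed.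

Let nc : noncrossing s. Proof. by case/is_ncppP: p_ncpp. Qed.

Let s_gt1 : (1 < size s)%N.
Proof. by have := is_ncpp_even p_ncpp; rewrite size_ppseq; lia. Qed.

Let gT : treelike 0%N s g. Proof. exact: Gseq_treelike. Qed.

Let sg : size g = k. Proof. by case: gT => ->; rewrite size_ppseq. Qed.

Let size_vertices : size V = (k./2).+1.
Proof. by case: gT => _ _ ->; rewrite size_ppseq. Qed.

Definition tree_edges := [seq (index e.1 V, index e.2 V) | e <- edges g].

Let mem_edges e : e \in edges g -> e.1 \in V /\ e.2 \in V.
Proof.
rewrite edgesE mem_undup => /mapP [j]; rewrite mem_iota /= add0n => jg ->.
have jg' : (j.+1 %% size g < size g)%N by rewrite ltn_mod sg.
by rewrite /uedge /edge /= !mem_undup /minn /maxn; case: ifP => _; rewrite !mem_nth.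
Qed.

Lemma tree_edgesP e : e \in tree_edges ->
  [/\ (e.1 < size V)%N, (e.2 < size V)%N & e.1 != e.2].
Proof.
move=> /mapP [f fg ->] /=; have [f1V f2V] := mem_edges fg; rewrite !index_mem; split=> //.
apply: contraNneq (treelike_loopless sP s_gt1 gT fg) => index_eq.
by rewrite -[f.1](nth_index 0%N f1V) index_eq nth_index.
Qed.

Lemma Jalpha_tree : Jalpha alpha s =
  fine (cube_int (size V) (fun x => (edge_prod (fun t => alpha t ^+ 2) tree_edges x)%:E)).
Proof.
rewrite /Jalpha; congr (fine (cube_int _ _)); apply/funext => x.
by rewrite /edge_prod big_map.
Qed.

Definition tree_avg N : R := cube_avg N (size V)
  (fun a => edge_prod (fun t => alpha t ^+ 2) tree_edges [seq i%:R / N%:R | i <- a]).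

Lemma tree_avg_cvg (C : R) : (forall x : R, 0 <= x <= 1 -> `|alpha x| <= C) ->
  riemann_integrable01 alpha -> tree_avg @ \oo --> Jalpha alpha s.
Proof.
move=> alpha_le /vanishing_oscillation_riemann alpha_osc; rewrite Jalpha_tree.
apply: (@cvg_cube_avg_edge_prod _ _ (C ^+ 2)) => // [x|x /alpha_le x_le||].
- exact: sqr_ge0.
- by rewrite -real_normK ?num_real // lerXn2r // nnegrE (le_trans _ x_le).
- exact: (vanishing_oscillation_sqr alpha_le alpha_osc).
- exact: tree_edgesP.
Qed.

Section FixedSize.
Variables (N : nat) (x0 : 'I_N).
Implicit Types (a : (size V).-tuple 'I_N) (i : k.-tuple 'I_N).

Let unfold a : k.-tuple 'I_N := [tuple nth x0 a (index (nth 0%N g j) V) | j < k].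

Let refold i : (size V).-tuple 'I_N := [tuple nth x0 i (index (nth 0%N V v) g) | v < size V].

Let nth_unfold a j : (j < k)%N -> nth x0 (unfold a) j = nth x0 a (index (nth 0%N g j) V).
Proof. by move=> jk; rewrite (nth_mktuple _ _ (Ordinal jk)). Qed.

Let nth_refold i v : (v < size V)%N -> nth x0 (refold i) v = nth x0 i (index (nth 0%N V v) g).
Proof. by move=> vV; rewrite (nth_mktuple _ _ (Ordinal vV)). Qed.

Let mem_vertices j : (j < k)%N -> nth 0%N g j \in V.
Proof. by move=> jk; rewrite mem_undup mem_nth // sg. Qed.

Let unfoldK : cancel unfold refold.
Proof.
move=> a; apply: val_inj; apply: (@eq_from_nth _ x0); rewrite !size_tuple // => v vV.
have vg : nth 0%N V v \in g by rewrite -mem_undup mem_nth.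
rewrite nth_refold // nth_unfold; last by rewrite -[X in (_ < X)%N]sg index_mem.
by rewrite nth_index // index_uniq // undup_uniq.
Qed.

Let refoldK i : folds x0 s i -> unfold (refold i) = i.
Proof.
move=> i_folds; apply: val_inj; apply: (@eq_from_nth _ x0); rewrite !size_tuple // => j jk.
have jg : nth 0%N g j \in g by rewrite mem_nth // sg.
rewrite nth_unfold // nth_refold ?index_mem ?mem_vertices // nth_index ?mem_vertices //.
apply: (treelike_factor sP nc s_gt1 gT _ i_folds); rewrite ?size_ppseq ?size_tuple //.
  by rewrite -[X in (_ < X)%N]sg index_mem.
by rewrite nth_index.
Qed.

Let edge_unfold a j : (j < k)%N -> edge x0 (unfold a) j =
  (nth x0 a (index (edge 0%N g j).1 V), nth x0 a (index (edge 0%N g j).2 V)).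
Proof. by move=> jk; rewrite /edge sg (size_tuple (unfold a)) !nth_unfold ?ltn_mod. Qed.

Let unfold_folds a : folds x0 s (unfold a).
Proof.
move=> j js; have [_ g_folds _] := gT; have [p_lt _ _] := sP js.
rewrite size_ppseq in js p_lt; rewrite !edge_unfold //.
by congr (nth x0 a (index _ V)); apply: g_folds; rewrite size_ppseq.
Qed.

Lemma tree_avgE : (N%:R ^+ (k./2).+1)^-1 *
  \sum_(i : k.-tuple 'I_N | `[< folds x0 s i >]) tree_term x0 alpha p i = tree_avg N.
Proof.
rewrite -size_vertices; congr (_ * _).
rewrite (reindex_onto unfold refold) => [|i /asboolP]; last exact: refoldK.
apply: eq_big => [a|a _].
  by rewrite unfoldK eqxx andbT; apply/asboolP; exact: unfold_folds.
have edges_perm := perm_openers_edges sP s_gt1 gT.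
rewrite /edge_prod big_map -(perm_big _ edges_perm) big_map /= big_filter /tree_term.
rewrite size_ppseq -[X in iota _ X](subn0 k) -/(index_iota _ _) big_mkord.
apply: eq_big => [j|j _]; first by rewrite nth_ppseq.
have coordE v : v \in V -> nth 0 [seq m%:R / N%:R | m <- map val a] (index v V) =
    (nth x0 a (index v V))%:R / N%:R :> R.
  move=> vV; rewrite (nth_map 0%N) ?(nth_map x0) ?size_map ?size_tuple ?index_mem //.
have jV : nth 0%N g j \in V by exact: mem_vertices.
have j1V : nth 0%N g (j.+1 %% size g) \in V by apply: mem_vertices; rewrite sg ltn_mod.
congr (_ ^+ 2); rewrite edge_unfold // /weight /=.
have -> (x y : R) : `|x - y| / N%:R = `|x / N%:R - y / N%:R|.
  by rewrite -mulrBl normrM [`|N%:R^-1|]ger0_norm ?invr_ge0.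
rewrite -!coordE // /uedge /edge /= /minn /maxn; congr alpha.
by case: ifP => _ //; rewrite distrC.
Qed.

End FixedSize.
End TreeAverages.

Section ScaledErrors.
Variable R : realType.

Lemma cvg_inv_sqrt : (fun N : nat => (Num.sqrt N%:R : R)^-1) @ \oo --> (0 : R).
Proof.
apply/cvgr0Pnorm_lt => e e_gt0.
have := nbhs_infty_gtr (e ^- 2); apply: filterS => N N_gt.
have N_gt0 : 0 < N%:R :> R by apply: le_lt_trans N_gt; rewrite invr_ge0 sqr_ge0.
rewrite ger0_norm ?invr_ge0 ?sqrtr_ge0 // -[e]invrK ltf_pV2 ?posrE ?invr_gt0 ?sqrtr_gt0 //.
by rewrite -[e^-1]ger0_norm ?invr_ge0 ?ltW // -sqrtr_sqr ltr_sqrt ?exprVn.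
Qed.

Definition scale k N : R := N%:R^-1 * (Num.sqrt N%:R)^-1 ^+ k.

Lemma scale_ge0 k N : 0 <= scale k N.
Proof. by rewrite mulr_ge0 ?invr_ge0 // exprn_ge0 // invr_ge0 sqrtr_ge0. Qed.

Lemma scale_even k N : ~~ odd k -> scale k N = (N%:R ^+ (k./2).+1)^-1.
Proof.
move=> k_even; rewrite /scale -{1}(even_halfK k_even) -muln2 mulnC exprM exprVn sqr_sqrtr //.
by rewrite -exprS exprVn.
Qed.

Lemma scale_uphalf k N : (0 < N)%N -> scale k N * N%:R ^+ (k.+1)./2 <= (Num.sqrt N%:R)^-1.
Proof.
move=> N_gt0; rewrite /scale; set q := Num.sqrt _.
have q2 : q ^+ 2 = N%:R by rewrite sqr_sqrtr.
have q_ge1 : 1 <= q by rewrite -sqrtr1 ler_sqrt // ler1n.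
have q_gt0 : 0 < q by exact: lt_le_trans q_ge1.
rewrite -q2 exprVn -invfM -exprM -exprD mulrC ler_pdivrMr ?exprn_gt0 //.
by rewrite ler_pdivlMl // -exprS ler_weXn2l //; lia.
Qed.

Variables (N : nat) (x0 : 'I_N) (r : rel ('I_N * 'I_N)) (B k : nat).
Hypothesis r_equiv : equivalence_rel r.
Hypothesis r_flip : forall p q : 'I_N, r (p, q) (q, p).
Hypothesis r_fibers : forall p q q' : 'I_N, (#|[set s | r (p, q) (q', s)]%SET| <= B)%N.
Hypothesis k_gt0 : (0 < k)%N.

Let N_gt0 : (0 < N)%N. Proof. exact: leq_ltn_trans (ltn_ord x0). Qed.

Lemma scaled_few_classes :
  scale k N * #|[set i : k.-tuple 'I_N | ((nclasses x0 r i).*2 < k)%N]%SET|%:R <=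
  (k ^ k * B ^ k)%:R * (Num.sqrt N%:R)^-1.
Proof.
have few_le := card_few_classes x0 r_equiv r_fibers k_gt0.
apply: (@le_trans _ _ (scale k N * ((k ^ k * B ^ k)%:R * N%:R ^+ (k.+1)./2))).
  by rewrite ler_wpM2l ?scale_ge0 // -natrX -natrM ler_nat mulnAC.
by rewrite mulrCA ler_wpM2l // scale_uphalf.
Qed.

Lemma scaled_exceptional (p : {ffun 'I_k -> 'I_k}) : is_pairing p ->
  scale k N * #|exceptional x0 r k (ppseq p)|%:R <= (k * B ^ k)%:R *
    ((max_vertex_equiv r)%:R / (N ^ 2)%:R + (open_corners r)%:R / (N ^ 2)%:R).
Proof.
move=> pP; have sP := pairing_ppseq pP.
have k_even : ~~ odd k by have := pairing_even sP; rewrite size_ppseq.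
have k_gt1 : (1 < k)%N by lia.
have := card_exceptional x0 r_equiv r_fibers r_flip (size_ppseq p) sP k_gt1.
rewrite -(ler_nat R) !natrM natrD; move: #|_|%:R => nexc exc_le.
have N_pos : 0 < N%:R :> R by rewrite ltr0n.
rewrite scale_even // mulrC ler_pdivrMr ?exprn_gt0 // -(ler_pM2r N_pos) (le_trans exc_le) //.
rewrite !natrX exprS le_eqVlt; apply/orP; left; apply/eqP; field.
by rewrite gt_eqF.
Qed.

Lemma scaled_nexceptions : scale k N * (nexceptions x0 r k)%:R <=
  (k ^ k * B ^ k)%:R * (Num.sqrt N%:R)^-1 + (#|{ffun 'I_k -> 'I_k}| * (k * B ^ k))%:R *
    ((max_vertex_equiv r)%:R / (N ^ 2)%:R + (open_corners r)%:R / (N ^ 2)%:R).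
Proof.
rewrite /nexceptions natrD mulrDr lerD ?scaled_few_classes //.
rewrite natr_sum mulr_sumr natrM -mulrA mulr_natl -sumr_const.
rewrite big_mkcond; apply: ler_sum => p _; case: ifP => [|_]; first exact: scaled_exceptional.
by rewrite mulr_ge0 // addr_ge0 // divr_ge0.
Qed.

End ScaledErrors.

Section MomentLimit.
Context (R : realType) (d : measure_display) (T : measurableType d) (P : probability T R).
Variables (X : forall N : nat, 'I_N -> 'I_N -> {RV P >-> R}) (alpha : R -> R).
Variables (r : forall N : nat, rel ('I_N * 'I_N)) (Rk : nat -> R) (C : R) (B k : nat).
Hypothesis alpha_le : forall x : R, 0 <= x <= 1 -> `|alpha x| <= C.
Hypothesis C_ge1 : 1 <= C.
Hypothesis X_sym : forall N (i j : 'I_N) w, X i j w = X j i w.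
Hypothesis X_mean : forall N (i j : 'I_N), ('E_P[X i j] = 0)%E.
Hypothesis X_var : forall N (i j : 'I_N), ('E_P[fun w => (X i j w ^+ 2)%R] = 1)%E.
Hypothesis X_moments : forall n N (i j : 'I_N),
  ('E_P[fun w => (`|X i j w| ^+ n)%R] <= (Rk n)%:E)%E.
Hypothesis r_equiv : forall N, equivalence_rel (@r N).
Hypothesis r_flip : forall N (p q : 'I_N), r (p, q) (q, p).
Hypothesis r_fibers : forall N (p q q' : 'I_N), (#|[set s | r (p, q) (q', s)]%SET| <= B)%N.
Hypothesis r_indep : forall N, indep_classes (@X N) (@r N).
Hypothesis k_gt0 : (0 < k)%N.

Definition error_bound N : R := error_const Rk k C *
  ((k ^ k * B ^ k)%:R * (Num.sqrt N%:R)^-1 + (#|{ffun 'I_k -> 'I_k}| * (k * B ^ k))%:R *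
    ((max_vertex_equiv (@r N))%:R / (N ^ 2)%:R + (open_corners (@r N))%:R / (N ^ 2)%:R)).

Lemma moment_error N : (0 < N)%N ->
  `|moment alpha X k N - \sum_(p : {ffun 'I_k -> 'I_k} | is_ncpp p) tree_avg alpha p N| <=
  error_bound N.
Proof.
move=> N_gt0; pose x0 : 'I_N := Ordinal N_gt0.
have trees : \sum_(p : {ffun 'I_k -> 'I_k} | is_ncpp p) tree_avg alpha p N = scale R k N *
    \sum_(p : {ffun 'I_k -> 'I_k} | is_ncpp p)
      \sum_(i : k.-tuple 'I_N | `[< folds x0 (ppseq p) i >]) tree_term x0 alpha p i.
  rewrite mulr_sumr; apply: eq_bigr => p p_ncpp.
  by rewrite -(tree_avgE alpha p_ncpp k_gt0 x0) scale_even ?(is_ncpp_even p_ncpp).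
have XN_moments n := X_moments n (N := N).
rewrite trees /moment (expected_trace_walks x0 XN_moments k_gt0) -mulrBr normrM.
rewrite (ger0_norm (scale_ge0 R k N)).
have := sum_trace_term_error x0 (@X_sym N) (@X_mean N) (@X_var N) XN_moments (@r_equiv N)
  (@r_flip N) (@r_indep N) k_gt0 alpha_le C_ge1.
move=> /(ler_wpM2l (scale_ge0 R k N)) /le_trans; apply; rewrite mulrCA.
rewrite ler_wpM2l ?(error_const_ge0 x0 XN_moments (@r_equiv N) k_gt0 alpha_le C_ge1) //.
exact: (scaled_nexceptions R x0 (@r_equiv N) (@r_flip N) (@r_fibers N) k_gt0).
Qed.

Lemma cvg_error_bound :
  (fun N => (max_vertex_equiv (@r N))%:R / (N ^ 2)%:R : R) @ \oo --> 0 ->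
  (fun N => (open_corners (@r N))%:R / (N ^ 2)%:R : R) @ \oo --> 0 ->
  error_bound @ \oo --> 0.
Proof.
move=> max_cvg corners_cvg.
rewrite -[X in _ --> X](mulr0 (error_const Rk k C)); apply: cvgMl_tmp.
rewrite -[X in _ --> X]addr0; apply: cvgD.
  by rewrite -[X in _ --> X](mulr0 (k ^ k * B ^ k)%:R); apply: cvgMl_tmp; exact: cvg_inv_sqrt.
rewrite -[X in _ --> X](mulr0 (#|{ffun 'I_k -> 'I_k}| * (k * B ^ k))%:R); apply: cvgMl_tmp.
by rewrite -[X in _ --> X]addr0; exact: cvgD.
Qed.

End MomentLimit.

Theorem mainTheorem8 (R : realType) (d : measure_display) (T : measurableType d)
  (P : probability T R) (alpha : R -> R)
  (X : forall N : nat, 'I_N -> 'I_N -> {RV P >-> R})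
  (eqv : forall N : nat, rel ('I_N * 'I_N)) :
  (* alpha bounded and Riemann-integrable on [0,1] *)
  (exists C : R, forall x : R, 0 <= x <= 1 -> `|alpha x| <= C) ->
  riemann_integrable01 alpha ->
  (* entries *)
  (forall N (i j : 'I_N) w, X N i j w = X N j i w) ->
  (forall N (i j : 'I_N), ('E_P[X N i j] = 0)%E) ->
  (forall N (i j : 'I_N), ('E_P[fun w => (X N i j w ^+ 2)%R] = 1)%E) ->
  (exists Rk : nat -> R, forall (k N : nat) (i j : 'I_N),
      ('E_P[fun w => (`|X N i j w| ^+ k)%R] <= (Rk k)%:E)%E) ->
  (* the equivalence relations *)
  (forall N, equivalence_rel (eqv N)) ->
  (forall N (p q : 'I_N), eqv N (p, q) (q, p)) ->
  (* (C1) *)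
  (fun N : nat => (\max_(p : 'I_N)
      #|[set t : 'I_N * 'I_N * 'I_N | eqv N (p, t.1.1) (t.1.2, t.2)]%SET|)%:R
      / (N ^ 2)%:R : R) @ \oo --> 0 ->
  (* (C2) *)
  (exists B : nat, forall N (p q r : 'I_N),
      (#|[set s : 'I_N | eqv N (p, q) (r, s)]%SET| <= B)%N) ->
  (* (C3) *)
  (fun N : nat => ((#|[set t : 'I_N * 'I_N * 'I_N |
      eqv N (t.1.1, t.1.2) (t.1.2, t.2) && (t.2 != t.1.1)]%SET|)%:R
      / (N ^ 2)%:R : R)) @ \oo --> 0 ->
  (* independence across equivalence classes *)
  (forall N, indep_classes (X N) (eqv N)) ->
  forall k : nat, (0 < k)%N ->
    moment alpha X k @ \oo -->
      (if odd k then 0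
       else \sum_(p : {ffun 'I_k -> 'I_k} | is_ncpp p) Jalpha alpha (ppseq p)).
Proof.
move=> [C0 alpha_le0] alpha_int X_sym X_mean X_var [Rk X_moments] eqv_equiv eqv_flip.
move=> max_cvg [B eqv_fibers] corners_cvg eqv_indep k k_gt0.
pose C := Num.max 1 C0; have C_ge1 : 1 <= C by rewrite le_max lexx.
have alpha_le x : 0 <= x <= 1 -> `|alpha x| <= C.
  by move=> /alpha_le0 le_C0; rewrite le_max le_C0 orbT.
have -> : (if odd k then 0
    else \sum_(p : {ffun 'I_k -> 'I_k} | is_ncpp p) Jalpha alpha (ppseq p)) =
    \sum_(p : {ffun 'I_k -> 'I_k} | is_ncpp p) Jalpha alpha (ppseq p).
  case: ifP => // k_odd; rewrite big_pred0 // => p; apply/negP => /is_ncpp_even.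
  by rewrite k_odd.
have trees_cvg : (fun N => \sum_(p : {ffun 'I_k -> 'I_k} | is_ncpp p) tree_avg alpha p N) @ \oo -->
    \sum_(p : {ffun 'I_k -> 'I_k} | is_ncpp p) Jalpha alpha (ppseq p).
  apply: cvg_big => [|p p_ncpp]; first exact: add_continuous.
  exact: (tree_avg_cvg p_ncpp k_gt0 alpha_le alpha_int).
apply: (cvg_sub0 _ trees_cvg); apply: norm_cvg0.
apply: (squeeze_cvgr _ (cvg_cst 0) (cvg_error_bound Rk C B k max_cvg corners_cvg)).
apply: filterS (nbhs_infty_gt 0) => N N_gt0; rewrite normr_ge0 /=.
exact: (moment_error alpha_le C_ge1 X_sym X_mean X_var X_moments eqv_equiv eqv_flip eqv_fibers
  eqv_indep k_gt0 N_gt0).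
Qed.
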